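(* Let $P_1,\dots,P_k:[q]\times[q]\to\{0,1\}$ be predicates and suppose there is a set of permutations $S\subseteq S_q$ such that (i) for every $a\in[q]$, if $\pi$ is chosen uniformly from $S$ then $\pi(a)$ is uniform in $[q]$, and (ii) for every $\pi\in S$, every $i$, and all $a,b$ with $P_i(a,b)=1$, also $P_i(\pi(a),\pi(b))=1$. Let $c=\min_i \mathbb E_{a,b\sim[q]}P_i(a,b)$ (with $a,b$ independent uniform). Then for every $\alpha>0$ there is $\varepsilon=\varepsilon(\alpha,q)>0$ such that the degree-$n^\alpha$ Sherali–Adams relaxation provides a $(c+\varepsilon)$-approximation to Max-$P$, the special case of 2CSP with alphabet $[q]$ in which every constraint predicate $\Pi_{ij}$ is one of $P_1,\dots,P_k$.
   Context: An $n$-variable 2CSP instance with alphabet $[q]$ is a pair $(G,\Pi)$: $G$ an $n$-vertex graph with nonnegative edge weights $w_{ij}$ summing to $1$ (simple, undirected, no isolated vertices) and predicates $\Pi_{ij}:[q]\times[q]\to\{0,1\}$ on edges; the value of $x\in[q]^n$ is $\sum w_{ij}\Pi_{ij}(x_i,x_j)$. A $q$-ary $t$-local pseudodistribution is a collection $\{\mu_S\}_{|S|=t}$ of distributions on $[q]^S$ whose marginals on any common subset of size at most $t$ agree; the degree-$t$ Sherali–Adams value $\mathrm{SA}_t(G,\Pi)$ is the maximum over these of $\sum w_{ij}\Pr_{\mu_{ij}}[\Pi_{ij}(X_i,X_j)=1]$. Providing a $\rho$-approximation means that for every instance the optimum value is at least $\rho\cdot\mathrm{SA}_{n^\alpha}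(G,\Pi)$.
   Formalization: The formal statement assumes in addition c < 1, i.e. that not every P_i is identically 1; if c = 1, every instance has optimum = SA value = 1 < c + ε, so the claim as written is false in that case. *)

(* Defs.v *)
From HB Require Import structures.
From mathcomp Require Import all_boot all_order all_algebra perm.
From mathcomp Require Import all_classical all_reals all_analysis.
Set Implicit Arguments.
Unset Strict Implicit.
Unset Printing Implicit Defensive.
Import Order.TTheory GRing.Theory Num.Theory.
Local Open Scope ring_scope.

(* [n] and [q] are the ordinals 'I_n and 'I_q.  The graph is undirected: the
   weight and the predicate of the edge {i,j} are stored at both (i,j) and
   (j,i), and sums over edges run over i < j.  Only values at edges matter. *)
Record csp (R : realType) (q n : nat) := Csp {
  edge : rel 'I_n;
  weight : 'I_n -> 'I_n -> R;
  constr : 'I_n -> 'I_n -> rel 'I_q;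
  edge_sym : symmetric edge;
  edge_irr : irreflexive edge;
  edge_nonisolated : forall i, exists j, edge i j;
  weight_sym : forall i j, edge i j -> weight j i = weight i j;
  weight_ge0 : forall i j, edge i j -> 0 <= weight i j;
  weight_sum1 : \sum_(i < n) \sum_(j < n | (i < j)%N && edge i j) weight i j = 1;
  constr_sym : forall i j, edge i j ->
    forall a b, constr j i b a = constr i j a b
}.

Definition value (R : realType) (q n : nat) (I : csp R q n)
    (x : {ffun 'I_n -> 'I_q}) : R :=
  \sum_(i < n) \sum_(j < n | (i < j)%N && edge I i j)
    weight I i j * (constr I i j (x i) (x j))%:R.

(* Values are nonnegative, so the default 0 is harmless when 0 < q. *)
Definition opt (R : realType) (q n : nat) (I : csp R q n) : R :=
  \big[Num.max/0]_(x : {ffun 'I_n -> 'I_q}) value I x.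

Definition local_assignment (q n : nat) (S : {set 'I_n}) : finType :=
  {ffun {i : 'I_n | i \in S} -> 'I_q}.

Definition is_distribution (R : realType) (T : finType) (p : T -> R) : Prop :=
  (forall x, 0 <= p x) /\ \sum_x p x = 1.

(* Only the mu S with #|S| = t are relevant for a t-local family. *)
Definition local_family (R : realType) (q n : nat) : Type :=
  forall S : {set 'I_n}, local_assignment q S -> R.

Definition agree (q n : nat) (S T : {set 'I_n})
    (g : local_assignment q S) (f : local_assignment q T) : bool :=
  [forall i, forall j, (val i == val j) ==> (g i == f j)].

(* For T \subset S, [agree g f] says that f is the restriction of g to T. *)
Definition marginal (R : realType) (q n : nat) (S T : {set 'I_n})
    (p : local_assignment q S -> R) (f : local_assignment q T) : R :=
  \sum_(g : local_assignment q S | agree g f) p g.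

Definition pseudodistribution (R : realType) (q n t : nat)
    (mu : local_family R q n) : Prop :=
  (forall S : {set 'I_n}, #|S| = t -> is_distribution (mu S)) /\
  (forall S S' T : {set 'I_n}, #|S| = t -> #|S'| = t ->
     T \subset S -> T \subset S' -> (#|T| <= t)%N ->
     forall f : local_assignment q T, marginal (mu S) f = marginal (mu S') f).

(* The marginal mu_T for #|T| <= t <= n; by consistency it does not depend on
   the chosen S. *)
Definition local_marginal (R : realType) (q n t : nat)
    (mu : local_family R q n) (T : {set 'I_n}) (f : local_assignment q T) : R :=
  if [pick S : {set 'I_n} | (#|S| == t) && (T \subset S)] is Some U
  then marginal (mu U) f else 0.

Definition pair_prob (R : realType) (q n t : nat) (mu : local_family R q n)
    (i j : 'I_n) (A : rel 'I_q) : R :=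
  \sum_(f : local_assignment q [set i; j] |
        A (f (exist _ i (set21 i j))) (f (exist _ j (set22 i j))))
    local_marginal t mu f.

Definition pseudo_value (R : realType) (q n t : nat) (I : csp R q n)
    (mu : local_family R q n) : R :=
  \sum_(i < n) \sum_(j < n | (i < j)%N && edge I i j)
    weight I i j * pair_prob t mu i j (constr I i j).

(* Meaningful for 2 <= t <= n. *)
Definition SA (R : realType) (q n t : nat) (I : csp R q n) : R :=
  sup [set v | exists2 mu : local_family R q n,
                 pseudodistribution t mu & v = pseudo_value t I mu]%classic.

(* The degree "n^alpha": its integer part, clamped to the range 2 .. n in which
   the relaxation makes sense.  Rounding down gives the weaker relaxation. *)
Definition sa_degree (R : realType) (n : nat) (alpha : R) : nat :=
  minn n (maxn 2 (Num.truncn (n%:R `^ alpha))).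

Definition SA_approximates (R : realType) (q : nat) (alpha rho : R)
    (C : forall n, csp R q n -> Prop) : Prop :=
  forall (n : nat) (I : csp R q n), C n I ->
    rho * SA (sa_degree n alpha) I <= opt I.

(* Predicates need not be symmetric, so an edge may carry P_l in either of its
   two orientations. *)
Definition max_csp (R : realType) (q k : nat) (P : 'I_k -> rel 'I_q)
    (n : nat) (I : csp R q n) : Prop :=
  forall i j, edge I i j ->
    exists l : 'I_k, constr I i j =2 P l \/ constr I j i =2 P l.

Definition density (R : realType) (q : nat) (A : rel 'I_q) : R :=
  (\sum_(a < q) \sum_(b < q) (A a b)%:R) / (q%:R ^+ 2).

(* Densities are at most 1, so 1 is neutral when 0 < k. *)
Definition min_density (R : realType) (q k : nat) (P : 'I_k -> rel 'I_q) : R :=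
  \big[Num.min/1]_(l < k) density R (P l).

Definition uniformly_transitive (R : realType) (q : nat) (S : {set 'S_q}) :
    Prop :=
  S != finset.set0 /\
  forall a b : 'I_q,
    #|[set s in S | s a == b]%SET|%:R / #|S|%:R = q%:R^-1 :> R.

Definition preserves (q : nat) (S : {set 'S_q}) (A : rel 'I_q) : Prop :=
  forall s, s \in S -> forall a b, A a b -> A (s a) (s b).

(* Main.v *)
Require Import Defs.
From mathcomp Require Import all_boot all_order all_algebra perm.
From mathcomp Require Import all_classical all_reals all_analysis.
From mathcomp Require Import ring lra zify.
Set Implicit Arguments.
Unset Strict Implicit.
Unset Printing Implicit Defensive.
Import Order.TTheory GRing.Theory Num.Theory.
Local Open Scope ring_scope.

(* Let v be the value of a pseudodistribution mu.  Applying independent random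
   permutations from S to the two sides of a cut keeps the values on the two
   sides and gives the crossing edges expected value at least c.  So it is enough
   to find, in every vertex set with edges, a cluster U that contains a constant
   fraction of the edge weight incident to it, with an assignment of U whose
   value is close to the pseudo-value of U: removing such clusters one after the
   other yields c + const - (1 - v).  If v is not close to 1, value c suffices.

   For U take a set all of whose subsets smaller by a factor n^a have much
   smaller internal weight, relative to their size; restarting in a violating
   subset finds one after O(1/a) rounds.  Condition mu on n^O(a) variables,
   chosen greedily so that the average over all pairs of U of the squared
   covariance C_ij is n^-O(a), and then sample the vertices independently.  This
   loses little unless C is at least some constant on average over the edges
   of U.  In that case, C being positive semidefinite on small sets, its
   average over the pairs at distance l of a random walk on U is at least
   exp(-O(l)).  By expansion the return probabilities of the walk decay at a much
   faster exponential rate, so for l proportional to log n the walk is nearly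
   spread out and, by Cauchy-Schwarz, C is too large on average over all pairs. *)

(** * Product weights and local positivity *)

(** Two exponential rates in the walk length [l = 2 ^ m] compete. Positivity keeps the correlation
    along the walk above about [H ^- l], where [1 / H] is, up to a constant, the correlation per
    edge that rounding tolerates, a power of [1 / q]. Expansion makes return probabilities fall like
    [(H ^ N) ^- l], and [l] is chosen with [n <= (H ^ N) ^ l]. Everything that costs degree
    (conditioned variables, samples that test positivity) is then polynomial in [H ^ l], which is at
    most [n ^ (2 / N)] for large [n], so [N] of order [1 / alpha] suffices. As [mu] is only local,
    there is no global positive semidefinite matrix and no spectral argument. Instead each passage
    from length [l] to [2l] is one use of positivity on few variables, hence the powers of two. A
    restart of the cluster search lowers the density by a constant factor but the size by a power of
    [n], so the fraction [rho] of weight kept by a cluster, and with it the gain, does not depend on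
    [n]. Densities are multiples of [1 / q ^ 2]; this gap between [c] and 1 pays for the rounding
    loss. *)

Section ProductWeights.
Variables (R : realFieldType) (I T : finType) (p : I -> T -> R).
Hypothesis p1 : forall k, \sum_a p k a = 1.

Lemma sum_prod_weight : \sum_(x : {ffun I -> T}) \prod_k p k (x k) = 1.
Proof. by rewrite -bigA_distr_bigA big1. Qed.

Lemma sum_prod_weight1 (i : I) (u : T -> R) :
  \sum_(x : {ffun I -> T}) (\prod_k p k (x k)) * u (x i) = \sum_a p i a * u a.
Proof.
have ii := eqxx i.
pose p' k a := if k == i then p k a * u a else p k a.
transitivity (\sum_(x : {ffun I -> T}) \prod_k p' k (x k)).
  apply: eq_bigr => x _; rewrite (bigD1 i) //= [RHS](bigD1 i) //= /p' ii.
  rewrite mulrAC; congr (_ * _); apply: eq_bigr => k /negbTE -> //.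
rewrite -bigA_distr_bigA (bigD1 i) //= [X in _ * X]big1 ?mulr1.
  by rewrite /p' ii.
by move=> k /negbTE ki; rewrite /p' ki p1.
Qed.

Lemma sum_prod_weight2 (i j : I) (G : T -> T -> R) : i != j ->
  \sum_(x : {ffun I -> T}) (\prod_k p k (x k)) * G (x i) (x j) =
  \sum_a \sum_b p i a * p j b * G a b.
Proof.
move=> ij.
have split2 (u v : T -> R) :
    \sum_(x : {ffun I -> T}) (\prod_k p k (x k)) * (u (x i) * v (x j)) =
    (\sum_a p i a * u a) * (\sum_b p j b * v b).
  pose p' k a := if k == i then p k a * u a else
                 if k == j then p k a * v a else p k a.
  have ji : j != i by rewrite eq_sym.
  have [ii jj] := (eqxx i, eqxx j).
  transitivity (\sum_(x : {ffun I -> T}) \prod_k p' k (x k)).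
    apply: eq_bigr => x _.
    rewrite (bigD1 i) //= (bigD1 j) //= [RHS](bigD1 i) //= [in RHS](bigD1 j) //=.
    rewrite /p' ii (negbTE ji) jj.
    rewrite [X in _ = _ * (_ * X)](_ : _ =
      \prod_(k | (k != i) && (k != j)) p k (x k)); first by ring.
    by apply: eq_bigr => k /andP[/negbTE -> /negbTE ->].
  rewrite -bigA_distr_bigA (bigD1 i) //= (bigD1 j) //= [X in _ * (_ * X)]big1 ?mulr1.
    by rewrite /p' ii (negbTE ji) jj.
  by move=> k /andP[/negbTE ki /negbTE kj]; rewrite /p' ki kj p1.
transitivity (\sum_(x : {ffun I -> T}) \sum_a
    (\prod_k p k (x k)) * ((x i == a)%:R * G a (x j))).
  apply: eq_bigr => x _; rewrite -mulr_sumr (bigD1 (x i)) //= eqxx mul1r [X in _ + X]big1.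
    by rewrite addr0.
  by move=> a; rewrite eq_sym => /negbTE ->; rewrite mul0r.
rewrite exchange_big /=; apply: eq_bigr => a _.
rewrite (split2 (fun c => (c == a)%:R) (G a)) (bigD1 a) //= eqxx mulr1 [X in _ + X]big1.
  by rewrite addr0 mulr_sumr; apply: eq_bigr => b _; rewrite mulrA.
by move=> c /negbTE ->; rewrite mulr0.
Qed.

End ProductWeights.

Lemma exists_ge_average (R : realFieldType) (T : finType) (w f : T -> R) :
  (forall x, 0 <= w x) -> \sum_x w x = 1 -> exists x, \sum_y w y * f y <= f x.
Proof.
move=> w0 w1; have [x0 _] : exists x : T, x \in T.
  case: (pickP (mem T)) => [x xT|T0]; first by exists x.
  by have /eqP := w1; rewrite big_pred0 // eq_sym oner_eq0.
exists [arg max_(x > x0) f x]%O; case: arg_maxP => //= x _ fx.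
rewrite -[leRHS]mul1r -w1 mulr_suml; apply: ler_sum => y _.
by apply: ler_wpM2l; [exact: w0 | exact: fx].
Qed.

(* The form is averaged over [s.+1] independent samples from [|f|]: only the
   diagonal pairs of samples are biased. *)
Lemma locally_psd_quadratic_ge (R : realFieldType) (V : finType) (s : nat)
    (C : V -> V -> R) (f : V -> R) :
  (0 < s)%N ->
  (forall (J : 'I_s.+1 -> V) (y : 'I_s.+1 -> R),
     0 <= \sum_a \sum_b y a * y b * C (J a) (J b)) ->
  (forall i, C i i <= 1) ->
  - (\sum_i `|f i|) ^+ 2 / s%:R <= \sum_i \sum_j f i * f j * C i j.
Proof.
move=> s0 psd C1; set N := \sum_i `|f i|.
have sR : 0 < s%:R :> R by rewrite ltr0n.
have N0 : 0 <= N by rewrite sumr_ge0.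
have [NE|NN] := eqVneq N 0.
  have f0 i : f i = 0.
    by apply: normr0_eq0; apply: (psumr_eq0P (P := predT) _ NE).
  rewrite NE expr0n /= oppr0 mul0r big1 // => i _; rewrite big1 // => j _.
  by rewrite f0 !mul0r.
have Npos : 0 < N by rewrite lt_def NN.
pose p (_ : 'I_s.+1) (i : V) := `|f i| / N.
have p1 k : \sum_a p k a = 1 by rewrite -mulr_suml divff.
(* The signs recover [f] from samples drawn from [|f|]: a pair of distinct samples contributes
   [Q / N ^ 2], a diagonal pair at most 1. *)
pose G i j := Num.sg (f i) * Num.sg (f j) * C i j.
have : 0 <= \sum_(x : {ffun 'I_s.+1 -> V}) (\prod_k p k (x k)) *
              (\sum_a \sum_b G (x a) (x b)).
  apply: sumr_ge0 => x _; apply: mulr_ge0; last exact: psd.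
  by apply: prodr_ge0 => k _; rewrite divr_ge0.
set Q := \sum_i \sum_j f i * f j * C i j.
have sampleE a : \sum_(x : {ffun 'I_s.+1 -> V}) (\prod_k p k (x k)) *
    (\sum_b G (x a) (x b)) = \sum_i p a i * G i i + Q / N ^+ 2 *+ s.
  under eq_bigr => x _ do rewrite mulr_sumr.
  rewrite exchange_big /= (bigD1 a) //=; congr (_ + _).
    exact: (sum_prod_weight1 p1 a (fun i => G i i)).
  transitivity (\sum_(b in predC1 a) Q / N ^+ 2); last first.
    by rewrite sumr_const cardC1 card_ord.
  apply: eq_bigr => b ba; rewrite (sum_prod_weight2 p1); last by rewrite eq_sym.
  rewrite /Q mulr_suml; apply: eq_bigr => i _; rewrite mulr_suml.
  apply: eq_bigr => j _; rewrite /p /G [in RHS](numEsg (f i)) [in RHS](numEsg (f j)).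
  by field.
under eq_bigr => x _ do rewrite mulr_sumr.
rewrite exchange_big /=; under eq_bigr => a _ do rewrite sampleE /p.
rewrite sumr_const card_ord => h.
have {}h : 0 <= 1 + Q / N ^+ 2 *+ s.
  have : 0 <= \sum_a p ord0 a * G a a + Q / N ^+ 2 *+ s.
    by move: h; rewrite pmulrn_lge0.
  move/le_trans; apply; rewrite lerD2r -(p1 ord0); apply: ler_sum => i _.
  rewrite ler_piMr // /p ?divr_ge0 // /G -expr2.
  by case: (sgrP (f i)) => _; rewrite ?expr0n ?expr1n ?sqrrN ?expr1n ?mul0r ?mul1r.
rewrite ler_pdivrMr // -subr_ge0 opprK -(pmulr_lge0 _ (x := (N ^+ 2)^-1)) ?invr_gt0 ?exprn_gt0 //.
rewrite mulrDl divff ?expf_neq0 // addrC; apply: le_trans h _.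
by rewrite -mulr_natr mulrAC.
Qed.

(** * Random walks on small-set expanders *)

Section RandomWalk.
Variables (R : realFieldType) (V : finType) (a : V -> V -> R).
Hypotheses (a_ge0 : forall i j, 0 <= a i j) (aC : forall i j, a i j = a j i).

Definition degree i := \sum_j a i j.
(** Functions are read as densities relative to the measure [degree]. This measure is reversible for
    the walk, so [walk] is self-adjoint for [inner] and preserves [mass]. *)
Definition mass f := \sum_i degree i * f i.
Definition inner f g := \sum_i degree i * (f i * g i).
Definition walk f i := (\sum_j a i j * f j) / degree i.

Lemma degree_ge0 i : 0 <= degree i.
Proof. exact: sumr_ge0. Qed.

(** This includes vertices of degree 0: there the row of [a] vanishes and both sides are 0. *)
Lemma degree_mul_walk f i : degree i * walk f i = \sum_j a i j * f j.
Proof.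
rewrite /walk mulrC; have [d0|d0] := eqVneq (degree i) 0; last by rewrite divfK.
rewrite d0 mulr0 big1 // => j _.
by rewrite (psumr_eq0P (fun k _ => a_ge0 i k) d0) ?mul0r.
Qed.

Lemma inner_walk f g : inner f (walk g) = \sum_i \sum_j a i j * (f i * g j).
Proof.
apply: eq_bigr => i _; rewrite mulrCA degree_mul_walk mulr_sumr.
by apply: eq_bigr => j _; rewrite mulrCA.
Qed.

Lemma inner_walkC f g : inner f (walk g) = inner (walk f) g.
Proof.
transitivity (inner g (walk f)); last by apply: eq_bigr => i _; rewrite (mulrC (g i)).
rewrite !inner_walk exchange_big /=; apply: eq_bigr => i _; apply: eq_bigr => j _.
by rewrite aC (mulrC (f j)).
Qed.

Lemma inner_iter_walk k l f g :
  inner (iter k walk f) (iter l walk g) = inner f (iter (k + l) walk g).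
Proof.
by elim: k l => //= k IH l; rewrite -inner_walkC -iterS IH addnS.
Qed.

Lemma mass_walk f : mass (walk f) = mass f.
Proof.
rewrite /mass; under eq_bigr => i _ do rewrite degree_mul_walk.
rewrite exchange_big /=; apply: eq_bigr => i _; rewrite /degree mulr_suml.
by apply: eq_bigr => j _; rewrite aC.
Qed.

Lemma walk_ge0 f : (forall i, 0 <= f i) -> forall i, 0 <= walk f i.
Proof.
move=> f0 i; apply: divr_ge0; last exact: degree_ge0.
by apply: sumr_ge0 => j _; apply: mulr_ge0.
Qed.

(** Jensen: the variance of [f] over one step from [i] is nonnegative, and [degree] is
    stationary. *)
Lemma inner_walk_le f : inner (walk f) (walk f) <= inner f f.
Proof.
have -> : inner f f = \sum_i \sum_j a i j * (f j * f j).
  rewrite exchange_big /=; apply: eq_bigr => i _; rewrite mulr_suml.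
  by apply: eq_bigr => j _; rewrite aC.
apply: ler_sum => i _; set c := walk f i.
have : 0 <= \sum_j a i j * (f j - c) ^+ 2.
  by apply: sumr_ge0 => j _; rewrite mulr_ge0 ?sqr_ge0.
have -> : \sum_j a i j * (f j - c) ^+ 2 =
    \sum_j a i j * (f j * f j) - c * 2 * (\sum_j a i j * f j) + degree i * (c * c).
  rewrite /degree mulr_suml mulr_sumr -sumrB -big_split /=.
  by apply: eq_bigr => j _; ring.
by rewrite -(degree_mul_walk f i) -/c; lra.
Qed.

(* Layer-cake induction on the support of [u], peeling off its least value. *)
Lemma sum_min_le (eta : R) (u : V -> R) :
  (forall i, 0 <= u i) ->
  (forall W : {set V}, (forall i, i \in W -> 0 < u i) ->
     \sum_(i in W) \sum_(j in W) a i j <= eta * \sum_(i in W) degree i) ->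
  \sum_i \sum_j a i j * Num.min (u i) (u j) <= eta * \sum_i degree i * u i.
Proof.
have [n] := ubnP #|[set i | u i != 0]|; elim: n u => // n IH u + u0 ue.
set W := [set i | u i != 0]; rewrite ltnS => Wn.
have [W0|[i1 i1W]] := finset.set_0Vmem W.
  have uz i : u i = 0 by apply/eqP; move/setP/(_ i): W0; rewrite !inE => /negbFE.
  rewrite big1 ?big1 ?mulr0 // => i _; first by rewrite uz mulr0.
  by rewrite big1 // => j _; rewrite !uz minxx mulr0.
have [i0 i0W mini0] : {i0 | i0 \in W & forall j, j \in W -> u i0 <= u j}.
  by case: (arg_minP u i1W) => i0 ? ?; exists i0.
set d := u i0; pose u' i := if i \in W then u i - d else 0.
have d0 : 0 < d by move: i0W; rewrite inE lt_def u0 andbT.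
have u'0 i : 0 <= u' i by rewrite /u'; case: ifP => // /mini0; rewrite subr_ge0.
have uE i : u i = u' i + d * (i \in W)%:R.
  rewrite /u'; case: ifP => [_|/negbT]; first by rewrite mulr1 subrK.
  by rewrite inE negbK => /eqP ->; rewrite mulr0 addr0.
have u'W i : 0 < u' i -> 0 < u i.
  by move=> h; rewrite uE ltr_wpDr // mulr_ge0 // ltW.
have IHu' : \sum_i \sum_j a i j * Num.min (u' i) (u' j) <=
    eta * \sum_i degree i * u' i.
  apply: IH => //; last by move=> X hX; apply: ue => i /hX /u'W.
  apply: leq_trans Wn; apply: proper_card; apply/properP; split.
    by apply/fintype.subsetP => i; rewrite !inE /u' inE; case: ifP; rewrite ?eqxx.
  by exists i0 => //; rewrite inE /u' i0W subrr eqxx.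
have W_gt0 i : i \in W -> 0 < u i by rewrite inE lt_def u0 andbT.
have -> : \sum_i \sum_j a i j * Num.min (u i) (u j) =
    \sum_i \sum_j a i j * Num.min (u' i) (u' j) +
    d * \sum_(i in W) \sum_(j in W) a i j.
  rewrite mulr_sumr [X in _ + X]big_mkcond -big_split /=; apply: eq_bigr => i _.
  case: ifPn => iW; last first.
    have u'i : u' i = 0 by rewrite /u' (negbTE iW).
    have ui : u i = 0 by rewrite uE u'i (negbTE iW) mulr0 addr0.
    by rewrite addr0; apply: eq_bigr => j _; rewrite ui u'i !min_l.
  rewrite mulr_sumr [X in _ + X]big_mkcond -big_split /=; apply: eq_bigr => j _.
  rewrite (uE i) (uE j) iW; have [jW|jW] := boolP (j \in W).
    by rewrite !mulr1 -addr_minl mulrDr (mulrC d).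
  have -> : u' j = 0 by rewrite /u' (negbTE jW).
  by rewrite mulr0 !addr0 !min_r // addr_ge0 // mulr1 ltW.
have -> : \sum_i degree i * u i =
    \sum_i degree i * u' i + d * \sum_(i in W) degree i.
  rewrite mulr_sumr [X in _ + X]big_mkcond -big_split /=; apply: eq_bigr => i _.
  by rewrite (uE i) mulrDr; case: (i \in W); rewrite ?mulr1 ?mulr0 ?(mulrC d).
rewrite mulrDr lerD // mulrCA ler_wpM2l ?(ltW d0) //.
exact: ue.
Qed.

Section SmallSetExpansion.
Variables (sigma tau lam : R).
Hypotheses (lam0 : 0 < lam) (tau0 : 0 < tau) (sigma_tau : 2 <= sigma * tau).
Hypothesis expand : forall W : {set V}, \sum_(i in W) degree i <= sigma ->
  \sum_(i in W) \sum_(j in W) a i j <= lam ^+ 2 * \sum_(i in W) degree i.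

(** Cut [m] at height [tau]. By Markov, the vertices above [tau] have total degree at most
    [2 / tau <= sigma], so expansion applies to every level set of the excess [m1], and [sum_min_le]
    applies to its square [u]. The part below [tau] costs at most [2 * tau * mass m <= 4 * tau]. *)
Lemma sum_pair_le (m : V -> R) : (forall i, 0 <= m i) -> mass m <= 2 ->
  \sum_i \sum_j a i j * (m i * m j) <= 3 / 2 * lam * inner m m + 4 * tau.
Proof.
move=> m0 m2.
pose m1 i := Num.max (m i - tau) 0; pose u i := m1 i * m1 i.
have m1_0 i : 0 <= m1 i by rewrite /m1 le_max lexx orbT.
have m1_le i : m1 i <= m i by rewrite /m1 ge_max m0 andbT; have := tau0; lra.
have m1_tau i : m i <= m1 i + tau.
  by have : m i - tau <= m1 i; [rewrite /m1 le_max lexx | lra].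
have u_min : \sum_i \sum_j a i j * Num.min (u i) (u j) <=
    lam ^+ 2 * \sum_i degree i * u i.
  apply: sum_min_le => [i|W hW]; first exact: mulr_ge0.
  apply: expand; rewrite -(ler_pM2r tau0); apply: le_trans sigma_tau.
  apply: le_trans m2; rewrite mulr_suml big_mkcond /=; apply: ler_sum => i _.
  case: ifP => [/hW ui|_]; last by rewrite mulr_ge0 ?degree_ge0.
  apply: ler_wpM2l; first exact: degree_ge0.
  rewrite leNgt; apply/negP => mt; move: ui.
  by rewrite /u /m1 max_r ?mul0r ?ltxx //; lra.
have u_le : \sum_i degree i * u i <= inner m m.
  apply: ler_sum => i _; apply: ler_wpM2l; first exact: degree_ge0.
  by apply: ler_pM.
have u_sum : \sum_i \sum_j a i j * (u i + u j) = 2 * \sum_i degree i * u i.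
  rewrite -[2]/(1 + 1) mulrDl mul1r.
  transitivity (\sum_i \sum_j a i j * u i + \sum_i \sum_j a i j * u j).
    rewrite -big_split /=; apply: eq_bigr => i _; rewrite -big_split /=.
    by apply: eq_bigr => j _; rewrite mulrDr.
  congr (_ + _); last rewrite exchange_big /=; apply: eq_bigr => i _;
    rewrite mulr_suml //.
  by apply: eq_bigr => j _; rewrite aC.
have m_sum : \sum_i \sum_j a i j * (m i + m j) = 2 * mass m.
  rewrite -[2]/(1 + 1) mulrDl mul1r.
  transitivity (\sum_i \sum_j a i j * m i + \sum_i \sum_j a i j * m j).
    rewrite -big_split /=; apply: eq_bigr => i _; rewrite -big_split /=.
    by apply: eq_bigr => j _; rewrite mulrDr.
  congr (_ + _); last rewrite exchange_big /=; apply: eq_bigr => i _;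
    rewrite mulr_suml //.
  by apply: eq_bigr => j _; rewrite aC.
(* AM-GM: [m1 i * m1 j = sqrt (min u) * sqrt (max u)]
   is at most [lam / 2 * max u + min u / (2 * lam)]. *)
have pw i j : m i * m j <= lam / 2 * (u i + u j) +
    (2 * lam)^-1 * Num.min (u i) (u j) + tau * (m i + m j).
  have h1 : m i * m j <= m1 i * m1 j + tau * (m i + m j).
    have := m0 i; have := m0 j; have := m1_0 i; have := m1_0 j.
    have := m1_tau i; have := m1_tau j; have := tau0; have := m1_le i; have := m1_le j.
    set x := m i; set y := m j; set x1 := m1 i; set y1 := m1 j => *.
    have : 0 <= (x1 + tau - x) * y by rewrite mulr_ge0 //; lra.
    have : 0 <= (y1 + tau - y) * x1 by rewrite mulr_ge0 //; lra.
    have : 0 <= tau * (x - x1) by rewrite mulr_ge0 //; lra.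
    lra.
  have h2 : m1 i * m1 j <= lam / 2 * (u i + u j) + (2 * lam)^-1 * Num.min (u i) (u j).
    rewrite -(ler_pM2l (mulr_gt0 (ltr0Sn R 1) lam0)) mulrDr.
    rewrite [X in _ <= _ + X]mulrA divff ?mul1r; last by rewrite mulf_neq0 ?pnatr_eq0 ?gt_eqF.
    have key (x y : R) : 0 <= x -> x <= y ->
        2 * lam * (x * y) <= 2 * lam * (lam / 2 * (x * x + y * y)) + x * x.
      move=> x0 xy; have : 0 <= (lam * y - x) ^+ 2 by exact: sqr_ge0.
      have : 0 <= (lam * x) ^+ 2 by exact: sqr_ge0.
      by lra.
    case: (leP (m1 i) (m1 j)) => h.
      by rewrite min_l; [exact: key | apply: ler_pM].
    rewrite min_r; last by apply: ler_pM => //; exact: ltW.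
    by rewrite (mulrC (m1 i)) (addrC (u i)); apply: key => //; exact: ltW.
  by lra.
apply: (@le_trans _ _ (\sum_i \sum_j a i j * (lam / 2 * (u i + u j) +
    (2 * lam)^-1 * Num.min (u i) (u j) + tau * (m i + m j)))).
  by apply: ler_sum => i _; apply: ler_sum => j _; apply: ler_wpM2l.
have -> : \sum_i \sum_j a i j * (lam / 2 * (u i + u j) +
    (2 * lam)^-1 * Num.min (u i) (u j) + tau * (m i + m j)) =
  lam / 2 * (2 * \sum_i degree i * u i) +
  (2 * lam)^-1 * (\sum_i \sum_j a i j * Num.min (u i) (u j)) + tau * (2 * mass m).
  rewrite -u_sum -m_sum !mulr_sumr -!big_split /=; apply: eq_bigr => i _.
  rewrite !mulr_sumr -!big_split /=; apply: eq_bigr => j _.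
  by rewrite !mulrDr !(mulrCA _ (a i j)).
have h3 : (2 * lam)^-1 * (\sum_i \sum_j a i j * Num.min (u i) (u j)) <=
    lam / 2 * \sum_i degree i * u i.
  apply: le_trans (_ : (2 * lam)^-1 * (lam ^+ 2 * \sum_i degree i * u i) <= _).
    by rewrite ler_wpM2l // invr_ge0 mulr_ge0 // ltW.
  by rewrite le_eqVlt; apply/orP; left; apply/eqP; field; rewrite gt_eqF.
have h4 : lam * \sum_i degree i * u i <= lam * inner m m by rewrite ler_pM2l.
have h5 : tau * mass m <= tau * 2 by rewrite ler_pM2l.
by lra.
Qed.

(** The left side pairs [walk g] with [g] along edges, while [sum_pair_le] has one function in both
    places. The pointwise maximum [m] dominates both; its mass is at most 2 and its squared norm at
    most twice that of [g]. *)
Lemma inner_walk_decay (g : V -> R) : (forall i, 0 <= g i) -> mass g = 1 ->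
  inner (walk g) (walk g) <= 3 * lam * inner g g + 4 * tau.
Proof.
move=> g0 g1; pose m i := Num.max (walk g i) (g i).
have w0 := walk_ge0 g0.
have m0 i : 0 <= m i by rewrite le_max g0 orbT.
have mm : mass m <= 2.
  apply: (@le_trans _ _ (mass (walk g) + mass g)); last by rewrite mass_walk g1; lra.
  rewrite /mass -big_split /=; apply: ler_sum => i _; rewrite -mulrDr.
  apply: ler_wpM2l; first exact: degree_ge0.
  by rewrite ge_max lerDl g0 lerDr w0.
have im : inner m m <= 2 * inner g g.
  apply: (@le_trans _ _ (inner (walk g) (walk g) + inner g g)).
    rewrite /inner -big_split /=; apply: ler_sum => i _; rewrite -mulrDr.
    apply: ler_wpM2l; first exact: degree_ge0.
    by rewrite /m; case: (leP (walk g i) (g i)) => _; rewrite ?lerDl ?lerDr mulr_ge0.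
  by have := inner_walk_le g; lra.
have := sum_pair_le m0 mm.
rewrite (inner_walk (walk g) g).
have : \sum_i \sum_j a i j * (walk g i * g j) <= \sum_i \sum_j a i j * (m i * m j).
  apply: ler_sum => i _; apply: ler_sum => j _; apply: ler_wpM2l => //.
  by apply: ler_pM => //; rewrite le_max lexx ?orbT.
have : lam * inner m m <= lam * (2 * inner g g) by rewrite ler_pM2l.
by lra.
Qed.

(** The errors [4 * tau] of the single steps form a geometric series of ratio at most 1/2, hence
    [8 * tau]. *)
Lemma inner_iter_walk_decay (l : nat) (g : V -> R) : 3 * lam <= 2^-1 ->
  (forall i, 0 <= g i) -> mass g = 1 ->
  inner (iter l walk g) (iter l walk g) <= (3 * lam) ^+ l * inner g g + 8 * tau.
Proof.
move=> lam_small g0 g1.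
have iter_g k : (forall i, 0 <= iter k walk g i) /\ mass (iter k walk g) = 1.
  by elim: k => //= k [h0 h1]; split; [exact: walk_ge0 | rewrite mass_walk].
elim: l => [|l IH]; first by rewrite expr0 mul1r lerDl; have := tau0; lra.
have [ge0 m1] := iter_g l.
have := inner_walk_decay ge0 m1; rewrite -iterS => /le_trans; apply.
move: IH; set x := inner _ _ => hx.
have : 3 * lam * x <= 3 * lam * ((3 * lam) ^+ l * inner g g + 8 * tau).
  by rewrite ler_pM2l // mulr_gt0.
have : 3 * lam * (8 * tau) <= 2^-1 * (8 * tau) by rewrite ler_wpM2r // mulr_ge0 // ltW.
rewrite exprS; lra.
Qed.

End SmallSetExpansion.
End RandomWalk.

(** * Correlations along random walks *)

Section CorrelationAlongWalk.
Variables (R : realFieldType) (V : finType) (a : V -> V -> R).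
Hypotheses (a_ge0 : forall i j, 0 <= a i j) (aC : forall i j, a i j = a j i).
Hypothesis a_sum : \sum_i \sum_j a i j = 1.
Variable C : V -> V -> R.
Hypotheses (C_ge0 : forall i j, 0 <= C i j) (C_le1 : forall i j, C i j <= 1).
Hypothesis CC : forall i j, C i j = C j i.

Local Notation pi := (degree a).

(** The density of the unit mass at [v] relative to [pi] (zero if [pi v] is 0). Thus
    [pi u * pi v * kernel l u v] is the probability that a stationary walk of [l] steps starts at
    one of [u], [v] and ends at the other, and [walk_correlation l] is the mean of [C] over its
    endpoints. *)
Definition point v i : R := (i == v)%:R / pi v.
Definition kernel l u v := inner a (point u) (iter l (walk a) (point v)).
Definition walk_correlation l := \sum_u \sum_v pi u * pi v * kernel l u v * C u v.

Let pi_ge0 := degree_ge0 a_ge0.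

Let innerC f g : inner a f g = inner a g f.
Proof. by apply: eq_bigr => i _; rewrite (mulrC (f i)). Qed.

Let point_ge0 v i : 0 <= point v i.
Proof. exact: divr_ge0. Qed.

Let iter_ge0 l v i : 0 <= iter l (walk a) (point v) i.
Proof. by elim: l i => //= l IH i; exact: walk_ge0. Qed.

Lemma degree_mul_inner_point u f : pi u * inner a (point u) f = pi u * f u.
Proof.
have [->|d0] := eqVneq (pi u) 0; first by rewrite !mul0r.
rewrite /inner (bigD1 u) //= [X in _ + X]big1 ?addr0.
  by rewrite /point eqxx /=; field.
by move=> i /negbTE iu; rewrite /point iu /=; ring.
Qed.

Lemma kernelC l u v : kernel l u v = kernel l v u.
Proof.
rewrite /kernel [RHS]innerC -[iter l _ (point u)]/(iter l (walk a) (point u)).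
by rewrite (inner_iter_walk a_ge0 aC l 0) addn0.
Qed.

Lemma kernel_ge0 l u v : 0 <= kernel l u v.
Proof. by apply: sumr_ge0 => i _; rewrite mulr_ge0 // mulr_ge0. Qed.

(** The midpoint [w] of the walk is stationary, and by reversibility both halves can be run away
    from it. *)
Lemma kernel_double l u v : kernel (l + l) u v =
  \sum_w pi w * (kernel l w u * kernel l w v).
Proof.
rewrite /kernel -(inner_iter_walk a_ge0 aC); apply: eq_bigr => w _.
rewrite [RHS]mulrA degree_mul_inner_point [RHS]mulrAC degree_mul_inner_point.
by rewrite mulrAC mulrA.
Qed.

Lemma kernel1 u v : pi u * pi v * kernel 1 u v = a u v.
Proof.
rewrite mulrAC degree_mul_inner_point /= degree_mul_walk // mulr_suml.
rewrite (bigD1 v) //= [X in _ + X]big1 ?addr0; last first.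
  by move=> i /negbTE iv; rewrite /point iv /=; ring.
rewrite /point eqxx /=; have [d0|d0] := eqVneq (pi v) 0; last by field.
rewrite d0 mulr0 aC.
by have := psumr_eq0P (fun k _ => a_ge0 v k) d0 => ->.
Qed.

Lemma sum_kernel l u : \sum_v pi v * kernel l u v = (pi u != 0)%:R.
Proof.
under eq_bigr => v _ do rewrite kernelC degree_mul_inner_point.
rewrite -/(mass a _); have -> : mass a (iter l (walk a) (point u)) = mass a (point u).
  by elim: l => //= l IH; rewrite mass_walk.
rewrite /mass (bigD1 u) //= [X in _ + X]big1 ?addr0; last first.
  by move=> i /negbTE iv; rewrite /point iv /=; ring.
rewrite /point eqxx /=; have [->|d0] := eqVneq (pi u) 0; first by rewrite mul0r.
by rewrite mul1r divff.
Qed.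

Lemma walk_correlation1 : walk_correlation 1 = \sum_u \sum_v a u v * C u v.
Proof. by apply: eq_bigr => u _; apply: eq_bigr => v _; rewrite kernel1. Qed.

Lemma walk_correlation_ge0 l : 0 <= walk_correlation l.
Proof.
apply: sumr_ge0 => u _; apply: sumr_ge0 => v _.
by rewrite !mulr_ge0 ?kernel_ge0.
Qed.

Lemma walk_correlation_le1 l : walk_correlation l <= 1.
Proof.
rewrite -a_sum; apply: ler_sum => u _.
apply: (@le_trans _ _ (pi u * \sum_v pi v * kernel l u v)).
  rewrite mulr_sumr; apply: ler_sum => v _; rewrite !mulrA ler_piMr //.
  by rewrite !mulr_ge0 ?kernel_ge0.
by rewrite sum_kernel ler_piMr ?lern1 ?leq_b1 //; case: eqP.
Qed.

(* Positivity is applied to [X_w] minus the average of the variables reached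
   from [w] by [l] steps. *)
Lemma walk_correlation_double (s l : nat) : (0 < s)%N ->
  (forall (J : 'I_s.+1 -> V) (y : 'I_s.+1 -> R),
     0 <= \sum_p \sum_q y p * y q * C (J p) (J q)) ->
  walk_correlation l ^+ 2 - 4 / s%:R <= walk_correlation (l + l).
Proof.
move=> s0 psd; set y := walk_correlation l.
have y0 : 0 <= y := walk_correlation_ge0 l.
have y1 : y <= 1 := walk_correlation_le1 l.
have sR : 0 < s%:R^-1 :> R by rewrite invr_gt0 ltr0n.
(* The coefficient [y] of [X_w] minimizes [x ^ 2 - 2 * x * y] over [x]. The absolute values of [f w]
   sum to at most [y + 1 <= 2], which gives the error [4 / s]. *)
pose f w u := y * (u == w)%:R - pi u * kernel l w u.
have fw w : - (4 / s%:R) <= \sum_u \sum_v f w u * f w v * C u v.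
  have := locally_psd_quadratic_ge (f w) s0 psd (fun i => C_le1 i i).
  move/(le_trans _); apply.
  rewrite mulNr lerN2 (ler_wpM2r (ltW sR)) //.
  suff [n0 n2] : 0 <= \sum_u `|f w u| /\ \sum_u `|f w u| <= 2.
    move: n0 n2; set N := \sum_u _ => n0 n2.
    by have : 0 <= (2 - N) * (2 + N); [apply: mulr_ge0; lra | lra].
  split; first exact: sumr_ge0.
  apply: (@le_trans _ _ (\sum_u (y * (u == w)%:R + pi u * kernel l w u))).
    apply: ler_sum => u _; apply: le_trans (ler_normB _ _) _.
    by rewrite !ger0_norm // ?mulr_ge0 ?kernel_ge0.
  rewrite big_split /= sum_kernel -mulr_sumr (bigD1 w) //= eqxx big1 ?addr0 ?mulr1.
    by have := leq_b1 (pi w != 0); rewrite -(ler_nat R); lra.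
  by move=> i /negbTE ->.
have expand_f w : \sum_u \sum_v f w u * f w v * C u v =
    y ^+ 2 * C w w - 2 * y * (\sum_u pi u * kernel l w u * C w u) +
    \sum_u \sum_v pi u * kernel l w u * (pi v * kernel l w v) * C u v.
  have e (g : V -> R) : \sum_u (u == w)%:R * g u = g w.
    rewrite (bigD1 w) //= eqxx mul1r big1 ?addr0 // => i /negbTE ->.
    by rewrite mul0r.
  have -> : y ^+ 2 * C w w = \sum_u \sum_v (u == w)%:R * ((v == w)%:R * (y ^+ 2 * C u v)).
    under eq_bigr => u _ do rewrite -mulr_sumr e.
    by rewrite e.
  have -> : 2 * y * (\sum_u pi u * kernel l w u * C w u) =
      \sum_u \sum_v (u == w)%:R * (y * (pi v * kernel l w v * C u v)) +
      \sum_u \sum_v (v == w)%:R * (y * (pi u * kernel l w u * C u v)).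
    under [in RHS]eq_bigr => u _ do rewrite -mulr_sumr.
    rewrite e; under [X in _ + X]eq_bigr => u _ do rewrite e CC.
    by rewrite -!mulr_sumr; ring.
  rewrite -!big_split -sumrB -big_split /=; apply: eq_bigr => u _.
  rewrite -!big_split -sumrB -big_split /=; apply: eq_bigr => v _.
  by rewrite /f; ring.
have pi_sum : \sum_w pi w = 1 by [].
have avg : - (4 / s%:R) <= \sum_w pi w * \sum_u \sum_v f w u * f w v * C u v.
  rewrite -[leLHS]mul1r -{1}pi_sum mulr_suml; apply: ler_sum => w _.
  by apply: ler_wpM2l.
have sum_diag : \sum_w pi w * C w w <= 1.
  by rewrite -pi_sum; apply: ler_sum => w _; rewrite ler_piMr.
have {avg} : - (4 / s%:R) <=
    y ^+ 2 * (\sum_w pi w * C w w) - 2 * y * y + walk_correlation (l + l).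
  apply: le_trans avg _; rewrite le_eqVlt; apply/orP; left; apply/eqP.
  rewrite {3}/y /walk_correlation !mulr_sumr.
  under eq_bigr => w _ do rewrite expand_f.
  have -> : \sum_u \sum_v pi u * pi v * kernel (l + l) u v * C u v =
      \sum_w pi w * \sum_u \sum_v pi u * kernel l w u * (pi v * kernel l w v) * C u v.
    under [in RHS]eq_bigr => w _ do rewrite mulr_sumr.
    rewrite [RHS]exchange_big /=; apply: eq_bigr => u _.
    under [in RHS]eq_bigr => w _ do rewrite mulr_sumr.
    rewrite [RHS]exchange_big /=; apply: eq_bigr => v _.
    rewrite kernel_double mulr_sumr mulr_suml; apply: eq_bigr => w _.
    by ring.
  rewrite -sumrB -big_split /=; apply: eq_bigr => w _.
  rewrite !mulrDr; congr (_ + _ + _); first by ring.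
  rewrite mulrN; congr (- _).
  rewrite !mulr_sumr; apply: eq_bigr => u _; ring.
have : y ^+ 2 * (\sum_w pi w * C w w) <= y ^+ 2 * 1 by rewrite ler_wpM2l ?sqr_ge0.
by lra.
Qed.

(** Each doubling squares the bound and loses [4 / s]. The spare factor 2 absorbs the loss, since
    [(2 * g) ^ 2 - 2 * g ^ 2 = 2 * g ^ 2], and [s] is large enough for [4 / s <= 2 * g ^ 2] even at
    the last doubling. *)
Lemma walk_correlation_pow2 (s m : nat) (h : R) : 0 < h <= 1 ->
  2 <= s%:R * h ^+ (2 ^ m) ->
  (forall (J : 'I_s.+1 -> V) (y : 'I_s.+1 -> R),
     0 <= \sum_p \sum_q y p * y q * C (J p) (J q)) ->
  2 * h <= walk_correlation 1 -> 2 * h ^+ (2 ^ m) <= walk_correlation (2 ^ m).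
Proof.
move=> /andP[h0 h1] sh psd F1.
have s0 : (0 < s)%N.
  by rewrite lt0n; apply: contraTneq sh => ->; rewrite mul0r -ltNge.
have : (m <= m)%N by []; elim: {1 3 4}m => [|j IH] jm; first by rewrite expr1.
have {IH} F := IH (ltnW jm).
have := walk_correlation_double (2 ^ j) s0 psd.
rewrite addnn -mul2n -expnS => /(le_trans _); apply.
set g := h ^+ _ in F; have -> : h ^+ (2 ^ j.+1) = g ^+ 2 by rewrite -exprM expnSr.
have g0 : 0 < g by rewrite exprn_gt0.
have hm : 4 / s%:R <= 2 * g ^+ 2.
  rewrite ler_pdivrMr ?ltr0n //.
  have : s%:R * h ^+ (2 ^ m) <= s%:R * g ^+ 2.
    rewrite ler_wpM2l // -exprM -expnSr ler_wiXn2l // ?ltW //.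
    by rewrite leq_exp2l.
  by lra.
have : (2 * g) ^+ 2 <= walk_correlation (2 ^ j) ^+ 2.
  by rewrite ler_sqr ?nnegrE ?walk_correlation_ge0 // mulr_ge0 // ltW.
by lra.
Qed.

(** Cauchy-Schwarz in linear form: [2 * th * x * C <= x ^ 2 + th ^ 2 * C ^ 2] for the kernel value
    [x], with [C ^ 2 <= C]. The first sum on the right is the trace of the walk of [2l] steps. *)
Lemma walk_correlation_le (l : nat) (th : R) :
  2 * th * walk_correlation l <=
  \sum_v pi v * inner a (iter l (walk a) (point v)) (iter l (walk a) (point v)) +
  th ^+ 2 * \sum_u \sum_v pi u * pi v * C u v.
Proof.
rewrite !mulr_sumr -big_split /=; apply: ler_sum => v _.
rewrite /inner !mulr_sumr -big_split /=; apply: ler_sum => u _.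
have -> : pi v * pi u * kernel l v u = pi v * pi u * iter l (walk a) (point v) u.
  by rewrite kernelC -!mulrA degree_mul_inner_point.
set x := iter _ _ _ _; set w := pi v * pi u.
have w0 : 0 <= w by rewrite mulr_ge0.
have : 0 <= w * (x - th * C v u) ^+ 2 by rewrite mulr_ge0 ?sqr_ge0.
have : w * (th ^+ 2 * (C v u * C v u)) <= w * (th ^+ 2 * C v u).
  by rewrite !ler_wpM2l ?sqr_ge0 // ler_piMr.
by rewrite (_ : pi v * (pi u * (x * x)) = w * x * x); [lra | rewrite /w; ring].
Qed.

Theorem edge_correlation_le (sigma tau lam h : R) (s m : nat) :
  0 < lam -> 3 * lam <= 2^-1 -> 0 < tau -> 2 <= sigma * tau ->
  (forall W : {set V}, \sum_(i in W) pi i <= sigma ->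
     \sum_(i in W) \sum_(j in W) a i j <= lam ^+ 2 * \sum_(i in W) pi i) ->
  0 < h <= 1 -> 2 <= s%:R * h ^+ (2 ^ m) ->
  (forall (J : 'I_s.+1 -> V) (y : 'I_s.+1 -> R),
     0 <= \sum_p \sum_q y p * y q * C (J p) (J q)) ->
  (3 * lam) ^+ (2 ^ m) * #|V|%:R <= 1 ->
  (1 + 8 * tau) * (\sum_u \sum_v pi u * pi v * C u v) < 4 * (h ^+ (2 ^ m)) ^+ 2 ->
  \sum_u \sum_v a u v * C u v <= 2 * h.
Proof.
move=> lam0 lam_small tau0 st expand h01 sh psd lamV small.
rewrite leNgt; apply/negP; rewrite -walk_correlation1 => /ltW F1.
have := walk_correlation_pow2 h01 sh psd F1.
move: small; set l := (2 ^ m)%N; set g := h ^+ l; set G := \sum_u _; move=> small F.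
have g0 : 0 < g by rewrite exprn_gt0 //; case/andP: h01.
set B := 1 + 8 * tau in small.
have B0 : 0 < B by rewrite /B; lra.
(* With this [th] the left side is at least [2 * B], whereas the trace is at most [B] and the
   smallness of [G] makes [th ^ 2 * G < B]. *)
have := walk_correlation_le l (B / (2 * g)); rewrite -/G.
(* Each vertex contributes at most [(3 * lam) ^ l], summing to at most 1 by the choice of [l], plus
   its share of [8 * tau]. *)
have : \sum_v pi v * inner a (iter l (walk a) (point v)) (iter l (walk a) (point v)) <= B.
  apply: (@le_trans _ _ (\sum_v ((3 * lam) ^+ l + pi v * (8 * tau)))); last first.
    rewrite big_split /= -mulr_suml (_ : \sum_v pi v = 1) // mul1r.
    by rewrite sumr_const -[X in X + _]mulr_natr /B lerD2r.
  apply: ler_sum => v _; have [->|d0] := eqVneq (pi v) 0.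
    by rewrite !mul0r addr0 exprn_ge0 // mulr_ge0 // ltW.
  have m1 : mass a (point v) = 1.
    rewrite /mass (bigD1 v) //= [X in _ + X]big1 ?addr0.
      by rewrite /point eqxx /= mul1r divff.
    by move=> i /negbTE iv; rewrite /point iv /=; ring.
  have := inner_iter_walk_decay a_ge0 aC lam0 tau0 st expand l lam_small (point_ge0 v) m1.
  move/(ler_wpM2l (pi_ge0 v)) => /le_trans; apply.
  rewrite mulrDr mulrCA degree_mul_inner_point /point eqxx mul1r divff //.
  by rewrite mulr1.
have : B / (2 * g) * (2 * g) <= B / (2 * g) * walk_correlation l.
  by rewrite ler_wpM2l // divr_ge0 // ?mulr_ge0 // ltW.
rewrite divfK; last by rewrite mulf_neq0 ?pnatr_eq0 ?gt_eqF.
have : (B / (2 * g)) ^+ 2 * G < B.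
  have -> : (B / (2 * g)) ^+ 2 * G = B * (B * G) / (4 * g ^+ 2).
    by field; rewrite gt_eqF.
  by rewrite ltr_pdivrMr ?ltr_pM2l // mulr_gt0 // exprn_gt0.
by lra.
Qed.

End CorrelationAlongWalk.

(** * Expanding clusters *)

Section Clusters.
Variables (R : realFieldType) (V : finType) (w : V -> V -> R).
Hypotheses (w_ge0 : forall i j, 0 <= w i j) (wC : forall i j, w i j = w j i).

(** The sum runs over ordered pairs, so an edge with both ends in [W] counts twice. *)
Definition inner_weight (W : {set V}) := \sum_(i in W) \sum_(j in W) w i j.

Lemma inner_weight_ge0 W : 0 <= inner_weight W.
Proof. by apply: sumr_ge0 => i _; apply: sumr_ge0. Qed.

Lemma inner_weightD1 (U : {set V}) i : i \in U ->
  inner_weight U - 2 * \sum_(j in U) w i j <= inner_weight (U :\ i).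
Proof.
move=> iU; rewrite /inner_weight (big_setD1 i) //=.
have -> : \sum_(k in U :\ i) \sum_(j in U) w k j =
    \sum_(k in U :\ i) w i k + \sum_(k in U :\ i) \sum_(j in U :\ i) w k j.
  by rewrite -big_split; apply: eq_bigr => k _; rewrite (big_setD1 i) //= (wC k).
rewrite (big_setD1 i iU) /=; have := w_ge0 i i; lra.
Qed.

Section Potential.
Variables (b : V -> R) (beta D eta : R).
Hypotheses (beta0 : 0 < beta) (b_ge : forall i, beta <= b i).
Hypotheses (D1 : 1 < D) (eta0 : 0 < eta).

Let size (W : {set V}) := \sum_(i in W) b i.

Let b_gt0 i : 0 < b i. Proof. exact: lt_le_trans (b_ge i). Qed.

Let size_ge (W : {set V}) : W != finset.set0 -> beta <= size W.
Proof.
case/finset.set0Pn => i iW; rewrite /size (big_setD1 i iW) /=.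
by rewrite (le_trans (b_ge i)) // lerDl sumr_ge0 // => j _; exact: ltW.
Qed.

Let size_gt0 (W : {set V}) : W != finset.set0 -> 0 < size W.
Proof. by move/size_ge; exact: lt_le_trans. Qed.

Let exists_densest (U0 : {set V}) : U0 != finset.set0 ->
  exists U : {set V}, [/\ U \subset U0, U != finset.set0 &
    forall W : {set V}, W \subset U0 -> W != finset.set0 ->
      inner_weight W * size U <= inner_weight U * size W].
Proof.
move=> U0n; pose P (U : {set V}) := (U \subset U0) && (U != finset.set0).
have P0 : P U0 by rewrite /P subxx.
case: (arg_maxP (fun U => inner_weight U / size U) P0) => U /andP[UU0 Un] Umax.
exists U; split=> // W WU Wn; have := Umax W; rewrite /P Wn WU => /(_ isT).
by rewrite /= ler_pdivrMr ?size_gt0 // mulrAC ler_pdivlMr ?size_gt0.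
Qed.

(** Deleting [i] cannot raise the density [inner_weight / size] of a densest set, so [i] has at
    least half of that density times [b i] as its degree inside [U]. This bound translates between
    degrees in the cluster and [size]. *)
Let densest_degree (U : {set V}) i :
  (forall W : {set V}, W \subset U -> W != finset.set0 ->
     inner_weight W * size U <= inner_weight U * size W) ->
  i \in U -> inner_weight U * b i <= 2 * (\sum_(j in U) w i j) * size U.
Proof.
move=> Umax iU; set d := \sum_(j in U) _.
have sU : size U = b i + size (U :\ i) by rewrite /size (big_setD1 i).
have [Ui0|Ui] := eqVneq (U :\ i) finset.set0.
  have UE : U = [set i] by rewrite -(finset.setD1K iU) Ui0 finset.setU0.
  rewrite sU Ui0 /size big_set0 addr0 ler_pM2r // /inner_weight UE !big_set1.
  rewrite -/d /d UE big_set1; have := w_ge0 i i; lra.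
have := Umax _ (finset.subD1set U i) Ui.
have : (inner_weight U - 2 * d) * size U <= inner_weight (U :\ i) * size U.
  by rewrite ler_wpM2r ?inner_weightD1 // ltW // size_gt0 //; apply/finset.set0Pn; exists i.
have -> : size (U :\ i) = size U - b i by rewrite sU; ring.
by lra.
Qed.

(* Take a densest nonempty subset of [U0].  If a much smaller subset of it is
   not much sparser, start again there; every restart divides [size] by [D]. *)
Lemma exists_expanding_cluster (K : nat) (r : R) (U0 : {set V}) :
  0 <= r -> U0 != finset.set0 -> \sum_(i in U0) b i <= D ^+ K * beta ->
  r * (\sum_(i in U0) b i) <= inner_weight U0 -> eta <= 1 ->
  exists U : {set V}, [/\ U \subset U0, U != finset.set0,
    r * eta ^+ K * (\sum_(i in U) b i) <= inner_weight U,
    (forall W : {set V}, W \subset U ->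
       (\sum_(i in W) b i) * D <= \sum_(i in U) b i ->
       inner_weight W * (\sum_(i in U) b i) <=
       eta * inner_weight U * (\sum_(i in W) b i)) &
    forall i, i \in U -> inner_weight U * b i <=
       2 * (\sum_(j in U) w i j) * \sum_(j in U) b j].
Proof.
move=> + + + + eta1; rewrite -!/(size _).
have sizeS (W U : {set V}) : W \subset U -> size W <= size U.
  move=> WU; rewrite /size [leRHS](big_setID W) /= (finset.setIidPr WU) lerDl.
  by apply: sumr_ge0 => j _; exact: ltW.
have step r' (U1 : {set V}) : 0 <= r' -> U1 != finset.set0 -> r' * size U1 <= inner_weight U1 ->
    exists U : {set V}, [/\ U \subset U1, U != finset.set0, r' * size U <= inner_weight U,
      forall i, i \in U ->
        inner_weight U * b i <= 2 * (\sum_(j in U) w i j) * size U &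
      (forall W : {set V}, W \subset U -> size W * D <= size U ->
         inner_weight W * size U <= eta * inner_weight U * size W) \/
      exists W : {set V}, [/\ W \subset U, W != finset.set0, size W * D <= size U &
         eta * inner_weight U * size W < inner_weight W * size U]].
  move=> r'0 U1n rU1; have [U [UU1 Un Umax]] := exists_densest U1n.
  exists U; split=> //.
  - rewrite -(ler_pM2r (size_gt0 U1n)) mulrAC; apply: le_trans (Umax _ _ U1n) => //.
    by rewrite ler_wpM2r // ltW // size_gt0.
  - by move=> i; apply: densest_degree => W WU; apply: Umax; apply: fintype.subset_trans WU _.
  pose bad (W : {set V}) := [&& W \subset U, size W * D <= size U &
    eta * inner_weight U * size W < inner_weight W * size U].
  case: (pickP bad) => [W /and3P[WU sW eW]|none]; [right|left].
    exists W; split=> //; apply: contraTneq eW => ->.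
    by rewrite /size /inner_weight !big_set0 mulr0 mul0r ltxx.
  move=> W WU sW; rewrite leNgt; apply/negP => eW.
  by have := none W; rewrite /bad WU sW eW.
elim: K r U0 => [|K IH] r U0 r0 U0n sU0 rU0;
  have [U [UU0 Un rU dU [good|[W [WU Wn sW eW]]]]] := step _ _ r0 U0n rU0.
- by exists U; split=> //; rewrite expr0 mulr1.
(* No restart is left: here [size U <= beta], so a violating [W] would be smaller than [beta], the
   least possible size of a nonempty set. *)
- have : size W * D <= beta.
    by apply: le_trans sW _; rewrite -[beta]mul1r -(expr0 D) (le_trans (sizeS _ _ UU0)).
  have : size W * 1 < size W * D by rewrite ltr_pM2l // size_gt0.
  by have := size_ge Wn; lra.
- exists U; split=> //; apply: le_trans rU; rewrite ler_wpM2r // ?(ltW (size_gt0 Un)) //.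
  by rewrite ler_piMr // exprn_ile1 // ltW.
have [|//|||U' [U'W U'n rU' gU' dU']] := IH (r * eta) W.
- by rewrite mulr_ge0 // ltW.
- rewrite -(ler_pM2r (lt_trans ltr01 D1)); apply: le_trans sW _.
  by apply: le_trans (sizeS _ _ UU0) _; apply: le_trans sU0 _; rewrite exprSr mulrAC.
- have sU := size_gt0 Un; rewrite -(ler_pM2r sU); apply: le_trans (ltW eW).
  have : r * size U * (eta * size W) <= inner_weight U * (eta * size W).
    by rewrite ler_wpM2r // mulr_ge0 // ltW // size_gt0.
  by rewrite le_eqVlt => /orP[/eqP|]; lra.
exists U'; split=> //; first exact: fintype.subset_trans U'W (fintype.subset_trans WU UU0).
by rewrite exprS mulrA.
Qed.
End Potential.
End Clusters.

(** * Correlations on the edges of an expanding cluster *)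

Section DecorrelatedCluster.
Variables (R : realFieldType) (V : finType) (w : V -> V -> R).
Hypotheses (w_ge0 : forall i j, 0 <= w i j) (wC : forall i j, w i j = w j i).

(** [U] is fixed before [C], because the variables conditioned on, and with them [C], will be chosen
    for the degree measure of [U]. Correlations shrink by at worst [1 / H] per step and return
    probabilities at least by [1 / H ^ N]. With [D = H ^ (2 ^ m)] one has [2 * #|V| <= D ^ N.+1],
    whence the [N.+1] restarts, each costing the factor [1 / (18 * (H ^ N) ^ 2)] in density. *)
Theorem exists_decorrelated_cluster (H N m : nat) (U0 : {set V}) :
  (1 < H)%N -> (0 < N)%N -> (#|V| <= (H ^ N) ^ (2 ^ m))%N ->
  0 < inner_weight w U0 ->
  exists U : {set V}, [/\ U \subset U0, 0 < inner_weight w U,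
    (18 * (H ^ N) ^ 2)%:R^-1 ^+ N.+1 / 2 * (\sum_(i in U) \sum_(j in U0) w i j)
      <= inner_weight w U &
    forall (s : nat) (C : V -> V -> R),
      (forall i j, 0 <= C i j) -> (forall i j, C i j <= 1) ->
      (forall i j, C i j = C j i) -> (2 * H ^ (2 ^ m) <= s)%N ->
      (forall (J : 'I_s.+1 -> V) (y : 'I_s.+1 -> R),
         0 <= \sum_p \sum_q y p * y q * C (J p) (J q)) ->
      9 * (H ^ (2 ^ m))%:R ^+ 3 * (\sum_(i in U) \sum_(j in U)
        (\sum_(k in U) w i k) * (\sum_(k in U) w j k) * C i j)
        <= inner_weight w U ^+ 2 ->
      \sum_(i in U) \sum_(j in U) w i j * C i j <= 2 / H%:R * inner_weight w U].
Proof.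
move=> H1 N0 Vle e0; set l := (2 ^ m)%N; set e := inner_weight w.
set eta := (18 * (H ^ N) ^ 2)%:R^-1 : R.
have l0 : (0 < l)%N by rewrite expn_gt0.
have A0 : (0 < H ^ N)%N by rewrite expn_gt0 (ltn_trans _ H1).
have A1 : (1 < H ^ N)%N by rewrite -[1%N](exp1n N) ltn_exp2r.
have [i0 i0U0] : exists i, i \in U0.
  apply/finset.set0Pn; apply: contraTneq e0 => ->.
  by rewrite /inner_weight big_set0 ltxx.
have n0 : (0 < #|V|)%N by apply/card_gt0P; exists i0.
have nR : 0 < #|V|%:R :> R by rewrite ltr0n.
(* The term [beta] keeps [b] within a factor polynomial in [#|V|], which
   bounds the number of restarts of the cluster search by [N.+1]. *)
pose beta := e U0 / #|V|%:R; pose b i := \sum_(j in U0) w i j + beta.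
pose D : R := (H ^ l)%:R.
have beta0 : 0 < beta by rewrite divr_gt0.
have b_ge i : beta <= b i by rewrite lerDr sumr_ge0.
have Hl : (1 < H ^ l)%N by rewrite -[1%N](exp1n l) ltn_exp2r.
have D1 : 1 < D by rewrite ltr1n.
have eta0 : 0 < eta by rewrite invr_gt0 ltr0n muln_gt0 expn_gt0 A0.
have eta1 : eta <= 1.
  by rewrite invf_le1 ?ltr0n ?ler1n muln_gt0 expn_gt0 A0.
have bU0 : \sum_(i in U0) b i <= 2 * e U0.
  rewrite big_split /= -/(e U0) sumr_const.
  rewrite (_ : 2 * e U0 = e U0 + #|V|%:R * beta); last by rewrite /beta; field; rewrite gt_eqF.
  by rewrite lerD2l -[beta *+ _]mulr_natl ler_wpM2r ?(ltW beta0) // ler_nat max_card.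
have U0n : U0 != finset.set0 by apply/finset.set0Pn; exists i0.
have r0 : 0 <= 2^-1 :> R by rewrite invr_ge0.
have [||U [UU0 Un rU expU dU]] :=
  exists_expanding_cluster w_ge0 wC beta0 b_ge D1 eta0
    (K := N.+1) r0 U0n _ _ eta1.
- apply: le_trans bU0 _.
  have -> : 2 * e U0 = (2 * #|V|)%:R * beta.
    by rewrite natrM /beta; field; rewrite gt_eqF.
  rewrite ler_wpM2r ?(ltW beta0) // -natrX ler_nat expnS leq_mul //.
  by rewrite -expnM mulnC expnM.
- by have := bU0; rewrite -/e; lra.
have bW (W : {set V}) : 0 <= \sum_(i in W) b i.
  by apply: sumr_ge0 => i _; rewrite (le_trans (ltW beta0)).
have bU : 0 < \sum_(i in U) b i.
  case/finset.set0Pn: Un => i iU; rewrite (big_setD1 i iU) /= ltr_pwDl //.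
  exact: lt_le_trans (b_ge i).
have eU : 0 < e U.
  apply: lt_le_trans rU; rewrite mulr_gt0 // mulr_gt0 ?invr_gt0 ?ltr0n //.
  exact: exprn_gt0.
exists U; split=> //.
  apply: le_trans rU; rewrite [_ / 2]mulrC ler_wpM2l //.
    by rewrite mulr_ge0 ?invr_ge0 // exprn_ge0 // ltW.
  by apply: ler_sum => i _; rewrite lerDl ltW.
move=> s C C0 C1 CC sH psd small.
pose a i j := if (i \in U) && (j \in U) then w i j / e U else 0.
have a_ge0 i j : 0 <= a i j by rewrite /a; case: ifP => // _; rewrite divr_ge0 // ltW.
have aC i j : a i j = a j i by rewrite /a andbC wC.
have aE i j : i \in U -> j \in U -> a i j = w i j / e U by rewrite /a => -> ->.
have a_out i j : i \notin U -> a i j = 0 by rewrite /a => /negbTE ->.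

have sum_in (W : {set V}) (f : V -> R) : (forall i, i \notin U -> f i = 0) ->
    \sum_(i in W) f i = \sum_(i in W :&: U) f i.
  move=> f0; rewrite [LHS](big_setID U) /= [X in _ + X]big1 ?addr0 // => i.
  by rewrite inE => /andP[/f0].
have sum_a (W : {set V}) (f : V -> V -> R) :
    \sum_(i in W) \sum_(j in W) a i j * f i j =
    (\sum_(i in W :&: U) \sum_(j in W :&: U) w i j * f i j) / e U.
  rewrite mulr_suml sum_in => [|i iU]; last first.
    by rewrite big1 // => j _; rewrite a_out ?mul0r.
  apply: eq_bigr => i; rewrite inE => /andP[_ iU].
  rewrite mulr_suml sum_in => [|j jU]; last by rewrite aC a_out ?mul0r.
  by apply: eq_bigr => j; rewrite inE => /andP[_ jU]; rewrite aE // mulrAC.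
have sumT (f : V -> R) : \sum_i f i = \sum_(i in [set: V]) f i.
  by apply: eq_bigl => i; rewrite inE.
have sumU (f : V -> R) : (forall i, i \notin U -> f i = 0) -> \sum_i f i = \sum_(i in U) f i.
  by move=> f0; rewrite sumT sum_in // finset.setTI.
pose d i := \sum_(j in U) w i j.
have deg_in i : i \in U -> degree a i = d i / e U.
  move=> iU; rewrite /degree sumU => [|j jU]; last by rewrite aC a_out.
  by rewrite /d mulr_suml; apply: eq_bigr => j jU; exact: aE.
have deg_out i : i \notin U -> degree a i = 0.
  by move=> iU; rewrite /degree big1 // => j _; rewrite a_out.
have sum_aT (f : V -> V -> R) : \sum_i \sum_j a i j * f i j =
    (\sum_(i in U) \sum_(j in U) w i j * f i j) / e U.
  have := sum_a [set: V] f; rewrite finset.setTI => <-.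
  by rewrite sumT; apply: eq_bigr => i _; rewrite sumT.
have sum_deg (W : {set V}) : \sum_(i in W) degree a i = (\sum_(i in W :&: U) d i) / e U.
  rewrite sum_in // mulr_suml; apply: eq_bigr => i; rewrite inE => /andP[_ iU].
  exact: deg_in.
have a_sum : \sum_i \sum_j a i j = 1.
  rewrite -/(\sum_i degree a i) sumT sum_deg finset.setTI divff // gt_eqF //.
have sum_aa (W : {set V}) : \sum_(i in W) \sum_(j in W) a i j = e (W :&: U) / e U.
  have := sum_a W (fun _ _ => 1).
  under eq_bigr => i _ do under eq_bigr => j _ do rewrite mulr1.
  by under [in RHS]eq_bigr => i _ do under eq_bigr => j _ do rewrite mulr1.
(* The bound [dU] is used twice: small degree gives [size] smaller by the factor [D], so that [W']
   is sparse relative to its [size], and then [size] is turned back into degree. This explains both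
   factors 2, in [2 * D] and in [2 * eta], the latter being the square of [1 / (3 * H ^ N)]. *)
have expand (W : {set V}) : \sum_(i in W) degree a i <= (2 * D)^-1 ->
    \sum_(i in W) \sum_(j in W) a i j <=
    ((3 * (H ^ N)%:R)^-1) ^+ 2 * \sum_(i in W) degree a i.
  rewrite sum_deg sum_aa; set W' := W :&: U => dW.
  have W'U : W' \subset U by exact: finset.subsetIr.
  have D0 : 0 < D by lra.
  have bd : e U * (\sum_(i in W') b i) <= 2 * (\sum_(i in W') d i) * \sum_(i in U) b i.
    have -> : 2 * (\sum_(i in W') d i) * (\sum_(i in U) b i) =
        \sum_(i in W') 2 * d i * (\sum_(i in U) b i).
      by rewrite -mulrA mulr_suml mulr_sumr; apply: eq_bigr => i _; rewrite mulrA.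
    rewrite mulr_sumr; apply: ler_sum => i iW.
    exact: (dU i (fintype.subsetP W'U _ iW)).
  have {}dW : 2 * D * (\sum_(i in W') d i) <= e U.
    by move: dW; rewrite ler_pdivrMr // ler_pdivlMl // mulr_gt0.
  have : e W' * (\sum_(i in U) b i) <= eta * e U * (\sum_(i in W') b i).
    apply: expU => //; rewrite -(ler_pM2l eU) mulrA.
    have : e U * (\sum_(i in W') b i) * D <=
        2 * (\sum_(i in W') d i) * (\sum_(i in U) b i) * D by rewrite ler_pM2r.
    have : 2 * D * (\sum_(i in W') d i) * (\sum_(i in U) b i) <=
        e U * (\sum_(i in U) b i) by rewrite ler_pM2r.
    by lra.
  have : eta * (e U * (\sum_(i in W') b i)) <=
      eta * (2 * (\sum_(i in W') d i) * \sum_(i in U) b i) by rewrite ler_pM2l.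
  move=> h1 h2; have : e W' <= 2 * eta * \sum_(i in W') d i.
    by rewrite -(ler_pM2r bU); lra.
  have -> : (3 * (H ^ N)%:R)^-1 ^+ 2 = 2 * eta.
    by rewrite /eta natrM (natrX _ (H ^ N)); field; rewrite pnatr_eq0 -lt0n.
  by rewrite mulrA ler_pM2r ?invr_gt0.
have HR : 0 < H%:R :> R by rewrite ltr0n ltnW.
have A1R : 2 <= (H ^ N)%:R :> R by rewrite (ler_nat R 2).
have D0 : 0 < D := lt_trans ltr01 D1.
suff : \sum_i \sum_j a i j * C i j <= 2 * H%:R^-1.
  by rewrite sum_aT ler_pdivrMr.
have HlE : H%:R^-1 ^+ (2 ^ m) = D^-1 :> R by rewrite exprVn -natrX.
have lamE : 3 * (3 * (H ^ N)%:R)^-1 = (H ^ N)%:R^-1 :> R.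
  by field; rewrite pnatr_eq0 -lt0n.
(* [tau = 4 * D] makes [sigma * tau = 2]. The cube of [D] in the hypothesis on [C] consists of one
   factor for [tau] and two for the squared lower bound [D ^- 2] on the correlation. *)
apply: (edge_correlation_le a_ge0 aC a_sum C0 C1 CC (sigma := (2 * D)^-1)
  (tau := 4 * D) (lam := (3 * (H ^ N)%:R)^-1) (s := s) (m := m)) => //.
- by rewrite invr_gt0 mulr_gt0 // ltr0n.
- by rewrite lamE lef_pV2 ?posrE ?ltr0n.
- by rewrite mulr_gt0.
- by rewrite le_eqVlt; apply/orP; left; apply/eqP; field; rewrite gt_eqF.
- by rewrite invr_gt0 HR /= invf_le1 // ler1n ltnW.
- by rewrite HlE ler_pdivlMr // -natrM ler_nat.
- by rewrite lamE exprVn mulrC ler_pdivrMr ?exprn_gt0 ?ltr0n // mul1r -natrX ler_nat.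
have -> : \sum_u \sum_v degree a u * degree a v * C u v =
    (\sum_(i in U) \sum_(j in U) d i * d j * C i j) / e U ^+ 2.
  rewrite mulr_suml sumU => [|i iU]; last first.
    by rewrite big1 // => j _; rewrite deg_out ?mul0r.
  apply: eq_bigr => i iU; rewrite mulr_suml sumU => [|j jU]; last first.
    by rewrite (deg_out j) // mulr0 mul0r.
  by apply: eq_bigr => j jU; rewrite !deg_in //; field; rewrite gt_eqF.
rewrite HlE; move: small; set G := \sum_(i in U) _ => small.
have GE : G / e U ^+ 2 <= (9 * D ^+ 3)^-1.
  by rewrite ler_pdivrMr ?exprn_gt0 // ler_pdivlMl ?mulr_gt0 ?exprn_gt0.
apply: (@le_lt_trans _ _ ((1 + 8 * (4 * D)) * (9 * D ^+ 3)^-1)).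
  by rewrite ler_wpM2l // addr_ge0 // !mulr_ge0 // ltW.
have -> : 4 * D^-1 ^+ 2 = (36 * D) * (9 * D ^+ 3)^-1 by field; rewrite gt_eqF.
by rewrite ltr_pM2r ?invr_gt0 ?mulr_gt0 ?exprn_gt0 //; have := D1; lra.
Qed.
End DecorrelatedCluster.

(** * Conditioning on a partition of a finite probability space *)

Section Indicator.
Variables (R : pzSemiRingType) (T : finType).

Lemma sum_indicator_mul (c : T) (G : T -> R) : \sum_a (c == a)%:R * G a = G c.
Proof.
rewrite (bigD1 c) //= eqxx mul1r big1 ?addr0 // => a.
by rewrite eq_sym => /negbTE ->; rewrite mul0r.
Qed.

Lemma sum_indicator (c : T) : \sum_a (c == a)%:R = 1 :> R.
Proof.
rewrite -[RHS](sum_indicator_mul c (fun=> 1)).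
by apply: eq_bigr => a _; rewrite mulr1.
Qed.
End Indicator.

Section Conditioning.
Variables (R : realFieldType) (V T Omega : finType) (nu : Omega -> R).
Variable X : V -> Omega -> T.
Hypotheses (nu_ge0 : forall o, 0 <= nu o) (nu_sum : \sum_o nu o = 1).

Section Law.
Variables (Z : finType) (chi : Z -> Omega -> R).

(* [chi] is a fractional partition of the sample space.  Conditional on the
   part [z], the law of [X i] is [pr1 z i / pr z], read as 0 when [pr z = 0]. *)
Definition pr z := \sum_o nu o * chi z o.
Definition pr1 z i a := \sum_o nu o * (chi z o * (X i o == a)%:R).
Definition pr2 z i a j b :=
  \sum_o nu o * (chi z o * (X i o == a)%:R * (X j o == b)%:R).
(** As [pr1] and [pr2] are not normalized, this is [pr z] times the conditional covariance. Hence
    [corr] averages over [z] the sum of the squared conditional covariances, and [energy] averages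
    the conditional collision probability of [X i]. *)
Definition cov z i a j b := pr2 z i a j b - pr1 z i a * pr1 z j b / pr z.
Definition corr i j := \sum_z \sum_a \sum_b cov z i a j b ^+ 2 / pr z.
Definition energy i := \sum_z \sum_a pr1 z i a ^+ 2 / pr z.

Hypotheses (chi_ge0 : forall z o, 0 <= chi z o) (chi_sum : forall o, \sum_z chi z o = 1).

Lemma pr_ge0 z : 0 <= pr z.
Proof. by apply: sumr_ge0 => o _; rewrite mulr_ge0. Qed.

Lemma pr1_ge0 z i a : 0 <= pr1 z i a.
Proof. by apply: sumr_ge0 => o _; rewrite !mulr_ge0. Qed.

Lemma pr2_ge0 z i a j b : 0 <= pr2 z i a j b.
Proof. by apply: sumr_ge0 => o _; rewrite !mulr_ge0. Qed.

Lemma sum_pr : \sum_z pr z = 1.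
Proof.
rewrite exchange_big /= -nu_sum; apply: eq_bigr => o _.
by rewrite -mulr_sumr chi_sum mulr1.
Qed.

Lemma sum_pr1 z i : \sum_a pr1 z i a = pr z.
Proof.
rewrite exchange_big /=; apply: eq_bigr => o _.
by rewrite -!mulr_sumr sum_indicator mulr1.
Qed.

Lemma sum_pr2r z i a j : \sum_b pr2 z i a j b = pr1 z i a.
Proof.
rewrite exchange_big /=; apply: eq_bigr => o _.
by rewrite -!mulr_sumr sum_indicator mulr1.
Qed.

Lemma pr2C z i a j b : pr2 z i a j b = pr2 z j b i a.
Proof. by apply: eq_bigr => o _; rewrite mulrAC. Qed.

Lemma corrC i j : corr i j = corr j i.
Proof.
apply: eq_bigr => z _; rewrite exchange_big /=.
by apply: eq_bigr => a _; apply: eq_bigr => b _; rewrite /cov pr2C (mulrC (pr1 _ i b)).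
Qed.

Lemma corr_ge0 i j : 0 <= corr i j.
Proof.
by do 3!(apply: sumr_ge0 => ? _); rewrite divr_ge0 ?sqr_ge0 ?pr_ge0.
Qed.

Lemma pr1_le z i a : pr1 z i a <= pr z.
Proof.
rewrite -(sum_pr1 z i) (bigD1 a) //= lerDl.
by apply: sumr_ge0 => b _; exact: pr1_ge0.
Qed.

Lemma pr2_le z i a j b : pr2 z i a j b <= pr1 z j b.
Proof.
rewrite pr2C -(sum_pr2r z j b i) (bigD1 a) //= lerDl.
by apply: sumr_ge0 => c _; exact: pr2_ge0.
Qed.

Lemma energy_ge0 i : 0 <= energy i.
Proof. by do 2!(apply: sumr_ge0 => ? _); rewrite divr_ge0 ?sqr_ge0 ?pr_ge0. Qed.

Lemma energy_le1 i : energy i <= 1.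
Proof.
rewrite -sum_pr; apply: ler_sum => z _; rewrite -[leRHS](sum_pr1 z i).
apply: ler_sum => a _; have [p0|p0] := eqVneq (pr z) 0.
  by rewrite p0 invr0 mulr0 pr1_ge0.
rewrite ler_pdivrMr ?lt_def ?p0 ?pr_ge0 // expr2.
by rewrite ler_wpM2l ?pr1_ge0 ?pr1_le.
Qed.

Lemma cov_eq0 z i a j b : pr z = 0 -> cov z i a j b = 0.
Proof.
move=> p0; rewrite /cov p0 invr0 mulr0 subr0; apply/eqP.
rewrite eq_le pr2_ge0 andbT (le_trans (pr2_le _ _ _ _ _)) //.
by rewrite (le_trans (pr1_le _ _ _)) ?p0.
Qed.

Definition centered z k c o : R := (X k o == c)%:R - pr1 z k c / pr z.
Definition overlap z k o o' := \sum_c centered z k c o * centered z k c o'.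

Lemma covE z i a j b :
  cov z i a j b = \sum_o nu o * chi z o * (centered z i a o * centered z j b o).
Proof.
have expand ci cj :
    \sum_o nu o * chi z o * (((X i o == a)%:R - ci) * ((X j o == b)%:R - cj)) =
    pr2 z i a j b - cj * pr1 z i a - ci * pr1 z j b + ci * cj * pr z.
  rewrite /pr2 /pr1 /pr !mulr_sumr -!sumrB -big_split /=.
  by apply: eq_bigr => o _; ring.
rewrite expand.
rewrite /cov; have [->|p0] := eqVneq (pr z) 0; first by rewrite !invr0; ring.
by field.
Qed.

(* The entrywise square of a Gram matrix is a Gram matrix: take two
   independent copies of the sample. *)
Lemma sum_cov2 z i j : \sum_a \sum_b cov z i a j b ^+ 2 =
  \sum_o \sum_o' nu o * chi z o * (nu o' * chi z o') *
    (overlap z i o o' * overlap z j o o').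
Proof.
pose w o a b := nu o * chi z o * (centered z i a o * centered z j b o).
transitivity (\sum_a \sum_b \sum_o \sum_o' w o a b * w o' a b).
  by apply: eq_bigr => a _; apply: eq_bigr => b _; rewrite covE expr2 big_distrlr.
under eq_bigr => a _ do rewrite exchange_big /=.
rewrite exchange_big /=; apply: eq_bigr => o _.
under eq_bigr => a _ do rewrite exchange_big /=.
rewrite exchange_big /=; apply: eq_bigr => o' _.
rewrite /overlap mulr_suml mulr_sumr; apply: eq_bigr => a _.
by rewrite !mulr_sumr; apply: eq_bigr => b _; rewrite /w; ring.
Qed.

Lemma corr_psd (I : finType) (J : I -> V) (y : I -> R) :
  0 <= \sum_p \sum_q y p * y q * corr (J p) (J q).
Proof.
have -> : \sum_p \sum_q y p * y q * corr (J p) (J q) =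
    \sum_z (pr z)^-1 *
      \sum_p \sum_q y p * y q * \sum_a \sum_b cov z (J p) a (J q) b ^+ 2.
  under [RHS]eq_bigr => z _ do rewrite mulr_sumr.
  rewrite [RHS]exchange_big /=; apply: eq_bigr => p _.
  under [RHS]eq_bigr => z _ do rewrite mulr_sumr.
  rewrite [RHS]exchange_big /=; apply: eq_bigr => q _.
  rewrite /corr mulr_sumr; apply: eq_bigr => z _.
  rewrite [RHS]mulrCA; congr (_ * _); rewrite mulr_sumr; apply: eq_bigr => a _.
  by rewrite mulr_sumr; apply: eq_bigr => b _; rewrite mulrC.
apply: sumr_ge0 => z _; rewrite mulr_ge0 ?invr_ge0 ?pr_ge0 //.
have -> : \sum_p \sum_q y p * y q * (\sum_a \sum_b cov z (J p) a (J q) b ^+ 2) =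
    \sum_o \sum_o' nu o * chi z o * (nu o' * chi z o') *
      (\sum_p y p * overlap z (J p) o o') ^+ 2.
  under eq_bigr => p _ do under eq_bigr => q _ do rewrite sum_cov2 mulr_sumr.
  under eq_bigr => p _ do rewrite exchange_big /=.
  rewrite exchange_big /=; apply: eq_bigr => o _.
  under eq_bigr => p _ do under eq_bigr => q _ do rewrite mulr_sumr.
  under eq_bigr => p _ do rewrite exchange_big /=.
  rewrite exchange_big /=; apply: eq_bigr => o' _.
  rewrite expr2 big_distrlr /= mulr_sumr; apply: eq_bigr => p _.
  by rewrite mulr_sumr; apply: eq_bigr => k _; ring.
apply: sumr_ge0 => o _; apply: sumr_ge0 => o' _.
by rewrite mulr_ge0 ?sqr_ge0 // !mulr_ge0.
Qed.

(* AM-GM: [cov <= th * pr + cov ^+ 2 / (4 * th * pr)]. *)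
Lemma product_value_ge (i j : V) (B : rel T) (th : R) : 0 < th ->
  \sum_z \sum_a \sum_b pr2 z i a j b * (B a b)%:R
    - (#|T|%:R ^+ 2 * th + corr i j / (4 * th)) <=
  \sum_z \sum_a \sum_b pr1 z i a * pr1 z j b / pr z * (B a b)%:R.
Proof.
move=> th0; rewrite lerBlDr.
have -> : #|T|%:R ^+ 2 * th + corr i j / (4 * th) =
    \sum_z \sum_(a : T) \sum_(b : T) (th * pr z + cov z i a j b ^+ 2 / pr z / (4 * th)).
  have cst (x : R) : \sum_(a : T) x = #|T|%:R * x by rewrite sumr_const mulr_natl.
  transitivity (\sum_z \sum_(a : T) \sum_(b : T) th * pr z +
                \sum_z \sum_a \sum_b cov z i a j b ^+ 2 / pr z / (4 * th)).
    congr (_ + _).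
      under [RHS]eq_bigr => z _ do rewrite !cst.
      by rewrite -!mulr_sumr sum_pr; ring.
    rewrite /corr mulr_suml; apply: eq_bigr => z _; rewrite mulr_suml.
    by apply: eq_bigr => a _; rewrite mulr_suml.
  by do 3!(rewrite -big_split /=; apply: eq_bigr => ? _).
rewrite -big_split; apply: ler_sum => z _; rewrite -big_split; apply: ler_sum => a _.
rewrite -big_split; apply: ler_sum => b _ /=.
have c0 : 0 <= th * pr z + cov z i a j b ^+ 2 / pr z / (4 * th).
  have [th_ge0 prz] := (ltW th0, pr_ge0 z).
  apply: addr_ge0; first exact: mulr_ge0.
  by apply: divr_ge0; [apply: divr_ge0 => //; exact: sqr_ge0 | exact: mulr_ge0].
suff : cov z i a j b <= th * pr z + cov z i a j b ^+ 2 / pr z / (4 * th).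
  by rewrite {1}/cov; case: (B a b) => /= h; lra.
have [p0|p0] := eqVneq (pr z) 0; first by rewrite cov_eq0 // in c0 *.
have {}p0 : 0 < pr z by rewrite lt_def p0 pr_ge0.
set c := cov _ _ _ _ _; rewrite -subr_ge0.
have -> : th * pr z + c ^+ 2 / pr z / (4 * th) - c =
    (c - 2 * th * pr z) ^+ 2 / (4 * th * pr z) by field; rewrite !gt_eqF.
by rewrite divr_ge0 ?sqr_ge0 // !mulr_ge0 // ltW.
Qed.

End Law.

Section Refinement.
Variables (Z : finType) (chi : Z -> Omega -> R) (j : V).
Hypotheses (chi_ge0 : forall z o, 0 <= chi z o) (chi_sum : forall o, \sum_z chi z o = 1).

Definition refine (zb : Z * T) o := chi zb.1 o * (X j o == zb.2)%:R.

Lemma refine_ge0 zb o : 0 <= refine zb o.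
Proof. exact: mulr_ge0. Qed.

Lemma refine_sum o : \sum_zb refine zb o = 1.
Proof.
rewrite -(chi_sum o) -(pair_bigA _ (fun z b => chi z o * (X j o == b)%:R)) /=.
by apply: eq_bigr => z _; rewrite -mulr_sumr sum_indicator mulr1.
Qed.

(** Conditioning on [X j] raises the energy by the variance of the conditional probabilities. For a
    part [z] and value [b] it is the squared covariance over [v = pr1 z j b], and [v <= pr z]. *)
Lemma energy_refine i : energy chi i + corr chi i j <= energy refine i.
Proof.
rewrite /energy -(pair_bigA _ (fun z b => \sum_a pr1 refine (z, b) i a ^+ 2 / pr refine (z, b))) /=.
rewrite -big_split /=; apply: ler_sum => z _.
rewrite [leRHS]exchange_big -big_split /=; apply: ler_sum => a _.
set P := pr chi z; set U := pr1 chi z i a; pose c := U / P.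
have P0 : 0 <= P by apply: pr_ge0.
have -> : U ^+ 2 / P = \sum_b (2 * c * pr2 chi z i a j b - c ^+ 2 * pr1 chi z j b).
  rewrite sumrB -!mulr_sumr sum_pr2r sum_pr1 // -/U -/P /c.
  by have [->|p0] := eqVneq P 0; [rewrite invr0; ring | field].
rewrite -big_split /=; apply: ler_sum => b _.
have -> : pr refine (z, b) = pr1 chi z j b by [].
have -> : pr1 refine (z, b) i a = pr2 chi z i a j b.
  by apply: eq_bigr => o _; rewrite /refine /= mulrAC.
rewrite /cov -/U -/P; set u := pr2 _ _ _ _ _ _; set v := pr1 _ _ _ _.
have u0 : 0 <= u by apply: pr2_ge0.
have uv : u <= v by apply: pr2_le.
have vP : v <= P by apply: pr1_le.
have -> : u - U * v / P = u - c * v by rewrite /c; ring.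
have [v0|v0] := eqVneq v 0.
  have -> : u = 0 by apply/le_anti; rewrite u0 -v0 uv.
  by rewrite v0 invr0 !mulr0 subrr expr0n /= mul0r addr0.
have {}v0 : 0 < v by rewrite lt_def v0 (le_trans u0).
have : (u - c * v) ^+ 2 / P <= (u - c * v) ^+ 2 / v.
  by rewrite ler_wpM2l ?sqr_ge0 // lef_pV2 // posrE (lt_le_trans v0).
have -> : (u - c * v) ^+ 2 / v = u ^+ 2 / v - (2 * c * u - c ^+ 2 * v).
  by field; rewrite gt_eqF.
by lra.
Qed.

(** One refinement raises the energy by at least [corr], and energies stay between 0 and 1. *)
Lemma corr_le1 i : corr chi i j <= 1.
Proof.
have := energy_refine i; have := energy_ge0 chi_ge0 i.
have := energy_le1 refine_ge0 refine_sum i; lra.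
Qed.

End Refinement.
End Conditioning.

(** * Pseudodistributions *)

Lemma exists_superset_card (T : finType) (B : {set T}) t :
  (#|B| <= t <= #|T|)%N -> exists2 S : {set T}, #|S| = t & B \subset S.
Proof.
case/andP=> Bt; rewrite -(subnKC Bt); elim: (t - #|B|)%N => [|d IH] dT.
  by exists B; rewrite ?addn0.
rewrite addnS in dT *; have [S St BS] := IH (ltnW dT).
have [i iS] : exists i, i \in ~: S.
  by apply/set0Pn; rewrite -card_gt0 -(ltn_add2l #|S|) addn0 cardsC St.
exists (i |: S); first by rewrite cardsU1 -finset.in_setC iS St.
exact: fintype.subset_trans BS (finset.subsetUr _ _).
Qed.

Section LocalExpectation.
Variables (R : realType) (q n t : nat) (mu : local_family R q n) (a0 : 'I_q).
Hypotheses (pd : pseudodistribution t mu) (tn : (t <= n)%N).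

Local Notation assignment := {ffun 'I_n -> 'I_q}.

(* The filler [a0] never matters: only functions of [S] are evaluated. *)
Definition extend (S : {set 'I_n}) (g : local_assignment q S) : assignment :=
  [ffun i => if insub i is Some u then g u else a0].

Definition local_E (S : {set 'I_n}) (f : assignment -> R) :=
  \sum_(g : local_assignment q S) mu g * f (extend g).

Definition junta (B : {set 'I_n}) (f : assignment -> R) :=
  forall x y : assignment, (forall i, i \in B -> x i = y i) -> f x = f y.

Lemma extendE (S : {set 'I_n}) (g : local_assignment q S) (u : {i | i \in S}) :
  extend g (val u) = g u.
Proof. by rewrite ffunE valK. Qed.

Lemma local_E_marginal (S B : {set 'I_n}) f : B \subset S -> junta B f ->
  local_E S f =
  \sum_(h : local_assignment q B) marginal (@mu S) h * f (extend h).
Proof.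
move=> BS fB; under [RHS]eq_bigr => h _ do rewrite /marginal mulr_suml.
rewrite (exchange_big_dep predT) //=; apply: eq_bigr => g _.
pose r : local_assignment q B := [ffun j => extend g (val j)].
rewrite (big_pred1 r) => [|h].
  congr (_ * _); apply: fB => i iB.
  by rewrite -[i in RHS]/(val (exist (fun i => i \in B) i iB)) extendE [RHS]ffunE.
apply/idP/eqP => [gh|->]; last first.
  apply/forallP => i; apply/forallP => j; apply/implyP => /eqP ij.
  by rewrite ffunE -ij extendE.
apply/ffunP => j; rewrite ffunE.
have jS : val j \in S by apply: (fintype.subsetP BS); exact: valP.
rewrite -[val j]/(val (exist (fun i => i \in S) _ jS)) extendE.
by move/forallP/(_ (exist (fun i => i \in S) _ jS))/forallP/(_ j): gh; rewrite eqxx => /eqP.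
Qed.

Lemma local_E_consistent (S S' B : {set 'I_n}) f :
  #|S| = t -> #|S'| = t -> B \subset S -> B \subset S' -> junta B f ->
  local_E S f = local_E S' f.
Proof.
move=> St S't BS BS' fB; rewrite !(@local_E_marginal _ B) //.
apply: eq_bigr => h _; congr (_ * _); apply: (proj2 pd) => //.
by rewrite -St subset_leq_card.
Qed.

(** Only sets of size exactly [t] carry a distribution, so smaller sets are evaluated inside some
    superset of that size; consistency makes the choice irrelevant. The default is not reached when
    [#|B| <= t <= n]. *)
Definition hull (B : {set 'I_n}) : {set 'I_n} :=
  odflt finset.set0 [pick S : {set 'I_n} | (#|S| == t) && (B \subset S)].

Lemma hullP (B : {set 'I_n}) : (#|B| <= t)%N -> #|hull B| = t /\ B \subset hull B.
Proof.
move=> Bt; rewrite /hull; case: pickP => [S /andP[/eqP ? ?] //|none].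
have [|S St BS] := @exists_superset_card _ B t; first by rewrite Bt card_ord.
by have := none S; rewrite St eqxx BS.
Qed.

Lemma pair_probE (i j : 'I_n) (S : {set 'I_n}) (B : rel 'I_q) :
  #|S| = t -> [set i; j]%SET \subset S ->
  pair_prob t mu i j B = local_E S (fun x => (B (x i) (x j))%:R).
Proof.
move=> St ijS.
have jun : junta [set i; j]%SET (fun x : assignment => (B (x i) (x j))%:R).
  by move=> x y xy; rewrite !xy // !inE eqxx ?orbT.
rewrite (local_E_marginal ijS jun) /pair_prob big_mkcond /=; apply: eq_bigr => h _.
rewrite -(extendE h (exist _ i (set21 i j))) -(extendE h (exist _ j (set22 i j))) /=.
case: (B _ _); rewrite ?mulr0 // mulr1 /local_marginal.
case: pickP => [U /andP[/eqP Ut ijU]|none].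
  by apply: (proj2 pd) => //; rewrite -St subset_leq_card.
by have := none S; rewrite St eqxx ijS.
Qed.

Section Partition.
Variables (Z : finType) (chi : Z -> assignment -> R) (B : {set 'I_n}).

(** [B] holds the variables conditioned on. The parts are functions of global assignments, so that
    one [chi] can be read in every local set containing [B]. *)
Definition is_partition := [/\ forall z, junta B (chi z),
  forall z x, 0 <= chi z x & forall x, \sum_z chi z x = 1].

Hypothesis part : is_partition.

Let X (S : {set 'I_n}) (i : 'I_n) (g : local_assignment q S) := extend g i.
Let chiS (S : {set 'I_n}) z (g : local_assignment q S) := chi z (extend g).

Definition local_pr S z := pr (@mu S) (@chiS S) z.
Definition local_pr1 S z i a := pr1 (@mu S) (@X S) (@chiS S) z i a.
Definition local_corr S i j := corr (@mu S) (@X S) (@chiS S) i j.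
Definition local_energy S i := energy (@mu S) (@X S) (@chiS S) i.

Lemma local_pr_consistent (S S' : {set 'I_n}) z : #|S| = t -> #|S'| = t -> B \subset S -> B \subset S' ->
  local_pr S z = local_pr S' z.
Proof.
by move=> *; apply: (@local_E_consistent _ _ B _) => //; case: part.
Qed.

Lemma local_pr1_consistent (S S' : {set 'I_n}) z i a : #|S| = t -> #|S'| = t ->
  i |: B \subset S -> i |: B \subset S' -> local_pr1 S z i a = local_pr1 S' z i a.
Proof.
move=> *; apply: (@local_E_consistent _ _ (i |: B)
  (fun x : assignment => chi z x * (x i == a)%:R)) => // x y xy.
rewrite xy ?setU11 //; congr (_ * _); case: part => jun _ _; apply: jun => k kB.
by apply: xy; rewrite setU1r.
Qed.

Lemma local_pr2_consistent (S S' : {set 'I_n}) z i a j b : #|S| = t -> #|S'| = t ->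
  i |: (j |: B) \subset S -> i |: (j |: B) \subset S' ->
  pr2 (@mu S) (@X S) (@chiS S) z i a j b = pr2 (@mu S') (@X S') (@chiS S') z i a j b.
Proof.
move=> *; apply: (@local_E_consistent _ _ (i |: (j |: B))
  (fun x : assignment => chi z x * (x i == a)%:R * (x j == b)%:R)) => // x y xy.
rewrite (xy i) ?setU11 // (xy j); last by rewrite setU1r ?setU11.
congr (_ * _ * _); case: part => jun _ _; apply: jun => k kB.
by apply: xy; rewrite !setU1r.
Qed.

Lemma local_corr_consistent (S S' : {set 'I_n}) i j : #|S| = t -> #|S'| = t ->
  i |: (j |: B) \subset S -> i |: (j |: B) \subset S' -> local_corr S i j = local_corr S' i j.
Proof.
move=> St S't hS hS'.
have [iBS iBS'] : i |: B \subset S /\ i |: B \subset S'.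
  by split; apply: fintype.subset_trans (finset.setUS _ (finset.subsetUr _ _)) _; eassumption.
have [jBS jBS'] : j |: B \subset S /\ j |: B \subset S'.
  by split; apply: fintype.subset_trans (finset.subsetUr _ _) _; eassumption.
have [BS BS'] : B \subset S /\ B \subset S'.
  by split; apply: fintype.subset_trans (finset.subsetUr _ _) _; eassumption.
apply: eq_bigr => z _; apply: eq_bigr => a _; apply: eq_bigr => b _.
rewrite /cov (@local_pr2_consistent S S') // -!/(local_pr1 _ _ _ _) -!/(local_pr _ _).
by rewrite !(@local_pr1_consistent S S') // !(@local_pr_consistent S S').
Qed.

Lemma local_energy_consistent (S S' : {set 'I_n}) i : #|S| = t -> #|S'| = t ->
  i |: B \subset S -> i |: B \subset S' -> local_energy S i = local_energy S' i.
Proof.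
move=> St S't hS hS'; apply: eq_bigr => z _; apply: eq_bigr => a _.
have [BS BS'] : B \subset S /\ B \subset S'.
  by split; apply: fintype.subset_trans (finset.subsetUr _ _) _; eassumption.
rewrite -!/(local_pr1 _ _ _ _) -!/(local_pr _ _).
by rewrite (@local_pr1_consistent S S') // (@local_pr_consistent S S').
Qed.

End Partition.
End LocalExpectation.

(** * Conditioning and rounding a pseudodistribution *)

Lemma leq_add_trans (a b c d e : nat) :
  (a <= b + c)%N -> (b <= d)%N -> (d + c <= e)%N -> (a <= e)%N.
Proof. lia. Qed.

Section Rounding.
Variables (R : realType) (q n t : nat) (mu : local_family R q n) (a0 : 'I_q).
Hypotheses (pd : pseudodistribution t mu) (tn : (t <= n)%N).

Local Notation assignment := {ffun 'I_n -> 'I_q}.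

Definition pseudo_corr (Z : finType) (chi : Z -> assignment -> R) (B : {set 'I_n}) i j :=
  local_corr mu a0 chi (hull t (i |: (j |: B))) i j.

Let mu_ge0 (S : {set 'I_n}) : #|S| = t -> forall g : local_assignment q S, 0 <= mu g.
Proof. by move=> /(proj1 pd)[]. Qed.

Let mu_sum (S : {set 'I_n}) : #|S| = t -> \sum_(g : local_assignment q S) mu g = 1.
Proof. by move=> /(proj1 pd)[]. Qed.

Let card_pair (i j : 'I_n) (B : {set 'I_n}) : (#|i |: (j |: B)| <= #|B| + 2)%N.
Proof.
by rewrite !cardsU1 (leq_trans (leq_add (leq_b1 _) (leq_add (leq_b1 _) (leqnn _)))) // addnA addnC.
Qed.

(* Condition greedily on one more variable as long as the correlations are
   large on average: each step raises the energy, which is at most 1. *)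
Lemma exists_decorrelating_partition (p : 'I_n -> R) (m : nat) :
  (forall i, 0 <= p i) -> \sum_i p i = 1 -> (0 < m)%N -> (m + 3 <= t)%N ->
  exists (Z : finType) (chi : Z -> assignment -> R) (B : {set 'I_n}),
    [/\ is_partition chi B, (#|B| <= m.+1)%N &
      m%:R * (\sum_i \sum_j p i * p j * pseudo_corr chi B i j) <= 1].
Proof.
move=> p0 p1 m0 mt.
pose En (Z : finType) (chi : Z -> assignment -> R) (B : {set 'I_n}) :=
  \sum_i p i * local_energy mu a0 chi (hull t (i |: B)) i.
have card1 i (B : {set 'I_n}) : (#|i |: B| <= #|B| + 1)%N.
  by rewrite cardsU1 addnC leq_add2l leq_b1.
have En_le1 (Z : finType) (chi : Z -> assignment -> R) (B : {set 'I_n}) :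
    is_partition chi B -> (#|B| <= m.+1)%N -> En Z chi B <= 1.
  move=> [_ c0 c1] Bm; rewrite -p1; apply: ler_sum => i _; rewrite ler_piMr //.
  have [|hc _] := @hullP n t tn (i |: B); first by apply: leq_add_trans (card1 i B) Bm _; lia.
  by apply: energy_le1 => //; [exact: mu_ge0 | exact: mu_sum].
(* After [k] steps the average correlation is at most [1 / m] or the average energy is at least
   [k / m]; the latter is impossible for [k = m.+1]. *)
have claim k : (k <= m.+1)%N -> exists (Z : finType) (chi : Z -> assignment -> R) (B : {set 'I_n}),
    [/\ is_partition chi B, (#|B| <= k)%N &
      m%:R * (\sum_i \sum_j p i * p j * pseudo_corr chi B i j) <= 1 \/
      k%:R <= m%:R * En Z chi B].
  elim: k => [|k IH] km.
    exists unit, (fun _ _ => 1), finset.set0; split; last right.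
    - by split=> // x; rewrite big_const card_unit /= addr0.
    - by rewrite cards0.
    rewrite mulr_ge0 // sumr_ge0 // => i _; rewrite mulr_ge0 //.
    have [|hc _] := @hullP n t tn (i |: finset.set0).
      by apply: leq_add_trans (card1 i _) (leqnn _) _; rewrite cards0; lia.
    by apply: energy_ge0 => //; exact: mu_ge0.
  have [Z [chi [B [part Bk [small|large]]]]] := IH (ltnW km).
    by exists Z, chi, B; split=> //; [exact: leqW | left].
  have [small|big] := leP (m%:R * (\sum_i \sum_j p i * p j * pseudo_corr chi B i j)) 1.
    by exists Z, chi, B; split=> //; [exact: leqW | left].
  have [j Gj] := exists_ge_average (fun j => \sum_i p i * pseudo_corr chi B i j) p0 p1.
  have {Gj} Gj : \sum_i \sum_j p i * p j * pseudo_corr chi B i j <=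
      \sum_i p i * pseudo_corr chi B i j.
    apply: le_trans Gj; rewrite exchange_big /= le_eqVlt; apply/orP; left; apply/eqP.
    by apply: eq_bigr => k' _; rewrite mulr_sumr; apply: eq_bigr => i _; ring.
  pose chi' (zb : Z * 'I_q) (x : assignment) := chi zb.1 x * (x j == zb.2)%:R.
  have [jun c0 c1] := part.
  exists (Z * 'I_q)%type, chi', (j |: B); split; last right.
  - split=> [zb x y xy|zb x|x]; last 1 first.
    + rewrite -(c1 x) -(pair_bigA _ (fun z b => chi z x * (x j == b)%:R)) /=.
      by apply: eq_bigr => z _; rewrite -mulr_sumr sum_indicator mulr1.
    + rewrite /chi' xy ?setU11 //; congr (_ * _); apply: jun => i iB.
      by apply: xy; rewrite setU1r.
    + exact: mulr_ge0.
  - by apply: leq_add_trans (card1 j B) Bk _; lia.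
  have En' : En Z chi B + \sum_i p i * pseudo_corr chi B i j <= En _ chi' (j |: B).
    rewrite /En -big_split /=; apply: ler_sum => i _; rewrite -mulrDr ler_wpM2l //.
    have [|hc ijB] := @hullP n t tn (i |: (j |: B)).
      by apply: leq_add_trans (card_pair i j B) Bk _; lia.
    have [|hc' iB] := @hullP n t tn (i |: B); first by apply: leq_add_trans (card1 i B) Bk _; lia.
    rewrite (@local_energy_consistent _ _ _ _ mu a0 pd _ chi B part _ (hull t (i |: (j |: B)))) //.
      by apply: energy_refine => //; exact: mu_ge0.
    by apply: fintype.subset_trans (finset.setUS _ (finset.subsetUr _ _)) ijB.
  have : m%:R * (En Z chi B + \sum_i p i * pseudo_corr chi B i j) <= m%:R * En _ chi' (j |: B).
    by rewrite ler_wpM2l.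
  have : m%:R * (\sum_i \sum_j p i * p j * pseudo_corr chi B i j) <=
      m%:R * (\sum_i p i * pseudo_corr chi B i j) by rewrite ler_wpM2l.
  rewrite -natr1; lra.
have [Z [chi [B [part Bm [small|large]]]]] := claim m.+1 (leqnn _).
  by exists Z, chi, B.
have : m%:R * En Z chi B <= m%:R * 1 by rewrite ler_wpM2l // En_le1.
by rewrite -natr1 in large; lra.
Qed.

Section Product.
Variables (Z : finType) (chi : Z -> assignment -> R) (B : {set 'I_n}).
Hypotheses (part : is_partition chi B) (Bt : (#|B| + 2 <= t)%N).

Let hull1 i : #|hull t (i |: B)| = t /\ i |: B \subset hull t (i |: B).
Proof. by apply: hullP => //; apply: leq_trans Bt; rewrite cardsU1 addnC leq_add2l (leq_trans (leq_b1 _)). Qed.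

Let hull2 i j : #|hull t (i |: (j |: B))| = t /\
  i |: (j |: B) \subset hull t (i |: (j |: B)).
Proof. by apply: hullP => //; exact: leq_trans (card_pair i j B) Bt. Qed.

Lemma pseudo_corr_ge0 i j : 0 <= pseudo_corr chi B i j.
Proof.
have [hc _] := hull2 i j; case: part => _ c0 _.
by apply: corr_ge0 => //; exact: mu_ge0.
Qed.

Lemma pseudo_corr_le1 i j : pseudo_corr chi B i j <= 1.
Proof.
have [hc _] := hull2 i j; case: part => _ c0 c1.
by apply: corr_le1 => //; [exact: mu_ge0 | exact: mu_sum].
Qed.

Lemma pseudo_corrC i j : pseudo_corr chi B i j = pseudo_corr chi B j i.
Proof. by rewrite /pseudo_corr finset.setUCA /local_corr corrC. Qed.

(** The [s] variables and [B] fit into one set of size [t]. By consistency all the correlations can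
    be computed there, under a genuine distribution. *)
Lemma pseudo_corr_psd (s : nat) (J : 'I_s -> 'I_n) (y : 'I_s -> R) : (#|B| + s <= t)%N ->
  0 <= \sum_p \sum_q y p * y q * pseudo_corr chi B (J p) (J q).
Proof.
move=> st; pose JB := [set J p | p in 'I_s]%SET :|: B.
have [|hc JBh] := @hullP n t tn JB.
  rewrite (leq_trans (leq_card_setU _ _)) // addnC (leq_trans _ st) // leq_add2l.
  by rewrite (leq_trans (leq_imset_card _ _)) // card_ord.
have -> : \sum_p \sum_q y p * y q * pseudo_corr chi B (J p) (J q) =
    \sum_p \sum_q y p * y q * local_corr mu a0 chi (hull t JB) (J p) (J q).
  apply: eq_bigr => p _; apply: eq_bigr => r _; congr (_ * _).
  have [hc2 h2] := hull2 (J p) (J r).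
  apply: (@local_corr_consistent _ _ _ _ mu a0 pd _ chi B part) => //.
  apply: fintype.subset_trans JBh; rewrite !finset.subUset !finset.sub1set finset.subsetUr andbT.
  by rewrite !finset.in_setU !imset_f.
case: part => _ c0 c1; apply: corr_psd => //; exact: mu_ge0.
Qed.

(** Only the weights of the parts and the one-vertex conditional laws enter the sampling, so it
    defines a true distribution on all assignments although [mu] is local. Each pair loses at most
    the bound of [product_value_ge]; [th] is left free. *)
Lemma exists_product_rounding (U : {set 'I_n}) (w : 'I_n -> 'I_n -> R)
    (Pi : 'I_n -> 'I_n -> rel 'I_q) (th : R) :
  (forall i j, 0 <= w i j) -> (forall i, w i i = 0) -> 0 < th ->
  exists x : assignment,
    \sum_(i in U) \sum_(j in U) w i j * (pair_prob t mu i j (Pi i j)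
       - (q%:R ^+ 2 * th + pseudo_corr chi B i j / (4 * th))) <=
    \sum_(i in U) \sum_(j in U) w i j * (Pi i j (x i) (x j))%:R.
Proof.
move=> w0 wii th0; have [jun c0 c1] := part.
have [hcB Bh] : #|hull t B| = t /\ B \subset hull t B by apply: hullP => //; exact: leq_trans (leq_addr _ _) Bt.
pose p z := local_pr mu a0 chi (hull t B) z.
pose p1 z i a := local_pr1 mu a0 chi (hull t (i |: B)) z i a.
have p_ge0 z : 0 <= p z by apply: pr_ge0 => //; exact: mu_ge0.
have p1_ge0 z i a : 0 <= p1 z i a.
  by apply: pr1_ge0 => //; apply: mu_ge0; case: (hull1 i).
have sum_p : \sum_z p z = 1 by apply: sum_pr => //; exact: mu_sum.
have sum_p1 z i : \sum_a p1 z i a = p z.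
  rewrite sum_pr1; apply: (@local_pr_consistent _ _ _ _ mu a0 pd _ chi B part) => //.
    by case: (hull1 i).
  by case: (hull1 i) => _; apply: fintype.subset_trans; exact: finset.subsetUr.
(* On a null part any law of total mass 1 will do, since the part has weight 0. *)
pose law z i a := if p z == 0 then q%:R^-1 else p1 z i a / p z.
have law_ge0 z i a : 0 <= law z i a by rewrite /law; case: ifP => _; rewrite ?invr_ge0 ?divr_ge0.
have q0 : q%:R != 0 :> R by rewrite pnatr_eq0 -lt0n; case: (a0) => ? /(leq_ltn_trans (leq0n _)).
have law1 z i : \sum_a law z i a = 1.
  rewrite /law; have [_|pz] := eqVneq (p z) 0; last by rewrite -mulr_suml sum_p1 divff.
  by rewrite sumr_const card_ord -[_^-1 *+ _]mulr_natl divff.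
pose val (x : assignment) :=
  \sum_(i in U) \sum_(j in U) w i j * (Pi i j (x i) (x j))%:R.
pose wt (zx : Z * assignment) := p zx.1 * \prod_i law zx.1 i (zx.2 i).
have wt_ge0 zx : 0 <= wt zx by rewrite mulr_ge0 // prodr_ge0.
have wt_sum : \sum_zx wt zx = 1.
  rewrite -(pair_bigA _ (fun z (x : assignment) => p z * \prod_i law z i (x i))) /= -[RHS]sum_p.
  by apply: eq_bigr => z _; rewrite -mulr_sumr (sum_prod_weight (law1 z)) mulr1.
have [[z0 x] /= xmax] := exists_ge_average (fun zx => val zx.2) wt_ge0 wt_sum.
exists x; apply: le_trans xmax.
have -> : \sum_zx wt zx * val zx.2 = \sum_(i in U) \sum_(j in U) w i j *
    \sum_z \sum_a \sum_b p1 z i a * p1 z j b / p z * (Pi i j a b)%:R.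
  rewrite -(pair_bigA _ (fun z (x : assignment) => p z * \prod_i law z i (x i) * val x)) /=.
  under eq_bigr => z _ do under eq_bigr => y _ do rewrite mulr_sumr.
  under eq_bigr => z _ do rewrite exchange_big /=.
  rewrite exchange_big /=; apply: eq_bigr => i _.
  under eq_bigr => z _ do under eq_bigr => y _ do rewrite mulr_sumr.
  under eq_bigr => z _ do rewrite exchange_big /=.
  rewrite exchange_big /=; apply: eq_bigr => j _.
  have [<-|ij] := eqVneq i j.
    by rewrite wii mul0r big1 // => z _; rewrite big1 // => y _; rewrite mul0r mulr0.
  rewrite mulr_sumr; apply: eq_bigr => z _.
  transitivity (w i j * (p z * \sum_(y : assignment) (\prod_k law z k (y k)) *
     (Pi i j (y i) (y j))%:R)).
    by rewrite !mulr_sumr; apply: eq_bigr => y _; ring.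
  rewrite (sum_prod_weight2 (law1 z) (fun a b => (Pi i j a b)%:R) ij); congr (_ * _).
  rewrite mulr_sumr; apply: eq_bigr => a _; rewrite mulr_sumr; apply: eq_bigr => b _.
  rewrite /law; case: eqP => [->|/eqP pz]; first by rewrite invr0; ring.
  by field.
apply: ler_sum => i _; apply: ler_sum => j _; apply: ler_wpM2l => //.
have [hc2 h2] := hull2 i j; set S := hull t (i |: (j |: B)).
have nu0 := mu_ge0 hc2.
have := product_value_ge (V := 'I_n) (fun k (g : local_assignment q S) => extend a0 g k)
  nu0 (mu_sum hc2) (chi := fun z g => chi z (extend a0 g))
  (fun z o => c0 z _) (fun o => c1 _) i j (Pi i j) th0.
rewrite card_ord; set L := \sum_z \sum_a \sum_b pr2 _ _ _ _ _ _ _ _ * _.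
have iBh : i |: B \subset S.
  by apply: fintype.subset_trans (finset.setUS _ (finset.subsetUr _ _)) h2.
have jBh : j |: B \subset S by apply: fintype.subset_trans (finset.subsetUr _ _) h2.
have BhS : B \subset S by apply: fintype.subset_trans (finset.subsetUr _ _) jBh.
have -> : L = pair_prob t mu i j (Pi i j).
  rewrite (@pair_probE _ _ _ _ mu a0 pd i j S) //; last first.
    by rewrite finset.subUset !finset.sub1set (fintype.subsetP iBh) ?setU11 ?(fintype.subsetP jBh) ?setU11.
  rewrite /L /pr2 /local_E.
  under eq_bigr => z _ do under eq_bigr => a _ do under eq_bigr => b _ do rewrite mulr_suml.
  under eq_bigr => z _ do under eq_bigr => a _ do rewrite exchange_big /=.
  under eq_bigr => z _ do rewrite exchange_big /=.
  rewrite exchange_big /=; apply: eq_bigr => g _.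
  rewrite -[RHS]mulr1 -[X in _ = _ * X](c1 (extend a0 g)) mulr_sumr; apply: eq_bigr => z _.
  transitivity (\sum_a (extend a0 g i == a)%:R * (\sum_b (extend a0 g j == b)%:R *
    (mu g * chi z (extend a0 g) * (Pi i j a b)%:R))).
    by apply: eq_bigr => a _; rewrite mulr_sumr; apply: eq_bigr => b _; ring.
  by rewrite !sum_indicator_mul; ring.
move/le_trans; apply; rewrite le_eqVlt; apply/orP; left; apply/eqP.
apply: eq_bigr => z _; apply: eq_bigr => a _; apply: eq_bigr => b _.
have [[hci hi] [hcj hj]] := (hull1 i, hull1 j).
congr (_ * _ / _ * _).
- exact: (@local_pr1_consistent _ _ _ _ mu a0 pd _ chi B part).
- exact: (@local_pr1_consistent _ _ _ _ mu a0 pd _ chi B part).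
- exact: (@local_pr_consistent _ _ _ _ mu a0 pd _ chi B part).
Qed.

End Product.
End Rounding.

(** * Rounding a cluster *)

(** The cluster depends on the weights alone. Its normalized degree measure [p] then guides the
    conditioning, which makes the [p]-average of the correlations at most [1 / (9 * D ^ 3)], as
    [exists_decorrelated_cluster] requires. *)
Lemma cluster_rounding (R : realType) (q n t N m : nat) (mu : local_family R q n)
    (w : 'I_n -> 'I_n -> R) (Pi : 'I_n -> 'I_n -> rel 'I_q) (U0 : {set 'I_n}) :
  let H := (16 * q ^ 6)%N in
  pseudodistribution t mu -> (t <= n)%N -> (0 < q)%N -> (0 < N)%N ->
  (n <= (H ^ N) ^ (2 ^ m))%N -> ((H ^ (2 ^ m)) ^ 4 <= t)%N ->
  (forall i j, 0 <= w i j) -> (forall i j, w i j = w j i) -> (forall i, w i i = 0) ->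
  0 < inner_weight w U0 ->
  exists U : {set 'I_n}, [/\ U \subset U0, 0 < inner_weight w U,
    (18 * (H ^ N) ^ 2)%:R^-1 ^+ N.+1 / 2 * (\sum_(i in U) \sum_(j in U0) w i j)
      <= inner_weight w U &
    exists x : {ffun 'I_n -> 'I_q},
      \sum_(i in U) \sum_(j in U) w i j * pair_prob t mu i j (Pi i j) -
        inner_weight w U / (2 * q%:R ^+ 2) <=
      \sum_(i in U) \sum_(j in U) w i j * (Pi i j (x i) (x j))%:R].
Proof.
move=> H pd tn q0 N0 nle Dt w0 wC wii e0.
have qq : (0 < q ^ 6)%N by rewrite expn_gt0 q0.
have H16 : (16 <= H)%N by rewrite /H; lia.
have [||||U [UU0 eU volU decor]] := @exists_decorrelated_cluster R _ w w0 wC H N m U0 => //.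
- by apply: leq_trans H16.
- by rewrite card_ord.
exists U; split=> //; set e := inner_weight w U in eU *.
set D := (H ^ (2 ^ m))%N in Dt decor.
have D16 : (16 <= D)%N.
  by rewrite (leq_trans H16) // -{1}[H]expn1 leq_pexp2l ?expn_gt0 // (leq_trans _ H16).
(* Room for the at most [9 * D ^ 3 + 1] conditioned variables together with the [2 * D + 1] samples
   in the positivity test. *)
have Dt3 : (9 * D ^ 3 + 2 * D + 4 <= t)%N.
  have : (9 * D ^ 3 + 2 * D + 4 <= D ^ 4)%N by rewrite !expnS expn0; nia.
  by move/leq_trans; apply.
have D3 : (0 < 9 * D ^ 3)%N by rewrite muln_gt0 expn_gt0 (leq_trans _ D16).
pose d i := \sum_(k in U) w i k.
pose p i := if i \in U then d i / e else 0.
have p0 i : 0 <= p i.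
  by rewrite /p; case: ifP => // _; apply: divr_ge0; [exact: sumr_ge0 | exact: ltW].
have p1 : \sum_i p i = 1.
  by rewrite -big_mkcond /= -mulr_suml divff // gt_eqF.
have a0 : 'I_q := Ordinal q0.
have [|Z [chi [B [part Bm small]]]] :=
  @exists_decorrelating_partition _ _ _ _ mu a0 pd tn p (9 * D ^ 3) p0 p1 D3.
  by lia.
have Bt : (#|B| + 2 <= t)%N by apply: leq_trans (leq_add Bm (leqnn 2)) _; lia.
have [[c0 c1] cC] := (pseudo_corr_ge0 a0 pd tn part Bt, pseudo_corr_le1 a0 pd tn part Bt, pseudo_corrC t mu a0 chi B).
have psd (J : 'I_(2 * D).+1 -> 'I_n) (y : 'I_(2 * D).+1 -> R) :
    0 <= \sum_k \sum_l y k * y l * pseudo_corr t mu a0 chi B (J k) (J l).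
  apply: pseudo_corr_psd => //.
  by apply: leq_trans (leq_add Bm (leqnn _)) _; lia.
have smallU : 9 * D%:R ^+ 3 * (\sum_(i in U) \sum_(j in U)
    (\sum_(k in U) w i k) * (\sum_(k in U) w j k) * pseudo_corr t mu a0 chi B i j) <= e ^+ 2.
  rewrite -natrX -natrM; move: small; set G := \sum_i _ => small.
  have -> : \sum_(i in U) \sum_(j in U) (\sum_(k in U) w i k) * (\sum_(k in U) w j k) *
      pseudo_corr t mu a0 chi B i j = e ^+ 2 * G.
    rewrite /G big_mkcond mulr_sumr; apply: eq_bigr => i _; rewrite /p.
    case: (i \in U); last by rewrite big1 ?mulr0 // => j _; rewrite !mul0r.
    rewrite big_mkcond mulr_sumr; apply: eq_bigr => j _.
    case: (j \in U); last by rewrite !(mulr0, mul0r).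
    by rewrite -/(d i) -/(d j); field; rewrite gt_eqF.
  by rewrite mulrCA ler_piMr // sqr_ge0.
have corrU := decor (2 * D)%N _ c0 c1 cC (leqnn _) psd smallU.
have qR : 0 < q%:R :> R by rewrite ltr0n.
(* The two loss terms become [1 / (4 * q ^ 2)] and, by [H = 16 * q ^ 6], at most [1 / (8 * q ^ 2)]
   per unit of weight, below the allowed [1 / (2 * q ^ 2)]. *)
pose th : R := (4 * q%:R ^+ 4)^-1.
have th0 : 0 < th by rewrite invr_gt0 mulr_gt0 // exprn_gt0.
have [x xge] := exists_product_rounding a0 pd tn part Bt U Pi w0 wii th0.
exists x; apply: le_trans xge.
have -> : \sum_(i in U) \sum_(j in U) w i j * (pair_prob t mu i j (Pi i j) -
      (q%:R ^+ 2 * th + pseudo_corr t mu a0 chi B i j / (4 * th))) =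
    \sum_(i in U) \sum_(j in U) w i j * pair_prob t mu i j (Pi i j) -
    (q%:R ^+ 2 * th * e +
     (\sum_(i in U) \sum_(j in U) w i j * pseudo_corr t mu a0 chi B i j) / (4 * th)).
  rewrite /e /inner_weight mulr_sumr mulr_suml -big_split -sumrB.
  apply: eq_bigr => i _; rewrite mulr_sumr mulr_suml -big_split -sumrB.
  by apply: eq_bigr => j _ /=; ring.
rewrite lerD2l lerN2.
set G := \sum_(i in U) _ in corrU *.
have HE : H%:R = 16 * q%:R ^+ 6 :> R by rewrite natrM natrX.
have -> : q%:R ^+ 2 * th * e = e / (4 * q%:R ^+ 2) by rewrite /th; field; rewrite gt_eqF.
have -> : G / (4 * th) = q%:R ^+ 4 * G by rewrite /th; field; rewrite gt_eqF.
have : q%:R ^+ 4 * G <= q%:R ^+ 4 * (2 / H%:R * e) by rewrite ler_wpM2l // exprn_ge0.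
have -> : q%:R ^+ 4 * (2 / H%:R * e) = e / (8 * q%:R ^+ 2) by rewrite HE; field; rewrite gt_eqF.
have E2 : 0 < e / q%:R ^+ 2 by rewrite divr_gt0 // exprn_gt0.
have -> : e / (2 * q%:R ^+ 2) = e / q%:R ^+ 2 / 2 by field; rewrite gt_eqF.
have -> : e / (4 * q%:R ^+ 2) = e / q%:R ^+ 2 / 4 by field; rewrite gt_eqF.
have -> : e / (8 * q%:R ^+ 2) = e / q%:R ^+ 2 / 8 by field; rewrite gt_eqF.
by lra.
Qed.

(** For [n] bounded in terms of [alpha] and [q], where the degree may leave no room for
    conditioning. The ends of a heaviest edge form the cluster: each has degree at most [n] times
    the weight of that edge. *)
Lemma heaviest_edge_rounding (R : realFieldType) (q n : nat) (w : 'I_n -> 'I_n -> R)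
    (Pi : 'I_n -> 'I_n -> rel 'I_q) (U0 : {set 'I_n}) :
  (forall i j, 0 <= w i j) -> (forall i j, w i j = w j i) -> (forall i, w i i = 0) ->
  (forall i j, w i j != 0 -> forall a b, Pi j i b a = Pi i j a b) ->
  (forall i j, w i j != 0 -> exists a b, Pi i j a b) ->
  0 < inner_weight w U0 ->
  exists U : {set 'I_n}, [/\ U \subset U0, 0 < inner_weight w U,
    n%:R^-1 * (\sum_(i in U) \sum_(j in U0) w i j) <= inner_weight w U &
    exists x : {ffun 'I_n -> 'I_q},
      inner_weight w U <= \sum_(i in U) \sum_(j in U) w i j * (Pi i j (x i) (x j))%:R].
Proof.
move=> w0 wC wii PiC sat e0.
pose P (ij : 'I_n * 'I_n) := (ij.1 \in U0) && (ij.2 \in U0).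
have [ij0 Pij0] : exists ij, P ij.
  have [i iU] : exists i, i \in U0.
    apply/set0Pn; apply: contraTneq e0 => ->.
    by rewrite /inner_weight big_set0 ltxx.
  by exists (i, i); rewrite /P /= iU.
have [[i j] /andP[/= iU jU] wmax] : {ij | P ij & forall kl, P kl -> w kl.1 kl.2 <= w ij.1 ij.2}.
  by case: (arg_maxP (fun ij => w ij.1 ij.2) Pij0) => ij ? ?; exists ij.
have nR : 0 <= n%:R :> R by [].
have n0 : 0 < n%:R :> R by rewrite ltr0n; case: (i) => ? /(leq_ltn_trans (leq0n _)).
have le_w k l : k \in U0 -> l \in U0 -> w k l <= w i j.
  by move=> kU lU; apply: (wmax (k, l)); rewrite /P /= kU.
have wij : 0 < w i j.
  rewrite lt_def w0 andbT; apply: contraTneq e0 => wij0.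
  rewrite -leNgt /inner_weight; apply: sumr_le0 => k kU; apply: sumr_le0 => l lU.
  by rewrite -wij0 le_w.
have ij : i != j by apply: contraTneq wij => ->; rewrite wii ltxx.
have sumU (g : 'I_n -> 'I_n -> R) : \sum_(k in [set i; j]%SET) \sum_(l in [set i; j]%SET) g k l =
    g i i + g i j + (g j i + g j j).
  have inj : i \notin [set j]%SET by rewrite finset.in_set1.
  by rewrite big_setU1 //= big_set1 !big_setU1 //= !big_set1.
have eU : inner_weight w [set i; j]%SET = 2 * w i j.
  by rewrite /inner_weight sumU !wii (wC j i); ring.
exists [set i; j]%SET; split; rewrite ?eU.
- by rewrite finset.subUset !finset.sub1set iU.
- by rewrite mulr_gt0.
- rewrite ler_pdivrMl // big_setU1 ?finset.in_set1 //= big_set1.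
  have row k : k \in U0 -> \sum_(l in U0) w k l <= n%:R * w i j.
    move=> kU; apply: (@le_trans _ _ (\sum_(l in U0) w i j)).
      by apply: ler_sum => l lU; exact: le_w.
    rewrite sumr_const -[_ *+ _]mulr_natl ler_wpM2r ?w0 // ler_nat.
    by rewrite -[leqRHS]card_ord max_card.
  by have := row i iU; have := row j jU; lra.
have wij0 : w i j != 0 by rewrite gt_eqF.
have [a [b ab]] := sat i j wij0.
exists [ffun k => if k == i then a else b].
rewrite sumU !ffunE eqxx eq_sym (negbTE ij) (PiC i j wij0) ab !wii (wC j i).
by rewrite !mul0r !mulr1; lra.
Qed.

(** * Assembling clusters *)

Lemma sum_uniformly_transitive (R : realType) (q : nat) (S : {set 'S_q})
    (f : 'I_q -> R) (a : 'I_q) : uniformly_transitive R S ->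
  \sum_(s in S) f (s a) / #|S|%:R = (\sum_c f c) / q%:R.
Proof.
case=> S0 tr; have Spos : #|S|%:R != 0 :> R by rewrite pnatr_eq0 cards_eq0.
transitivity (\sum_(s in S) \sum_c (s a == c)%:R * (f c / #|S|%:R)).
  by apply: eq_bigr => s _; rewrite sum_indicator_mul.
rewrite exchange_big /= mulr_suml; apply: eq_bigr => c _.
have cnt : \sum_(s in S) (s a == c)%:R = #|[set s in S | s a == c]%SET|%:R :> R.
  rewrite -sum1_card natr_sum [RHS](eq_bigl (fun s => (s \in S) && (s a == c))); last first.
    by move=> s; rewrite !finset.inE.
  by rewrite big_mkcondr /=; apply: eq_bigr => s _; case: (s a == c).
by rewrite -(tr a c) -mulr_suml cnt; ring.
Qed.

Lemma sum_setID2 (R : realFieldType) (T : finType) (U U0 : {set T}) (g : T -> T -> R) :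
  U \subset U0 -> (forall i j, g i j = g j i) ->
  \sum_(i in U0) \sum_(j in U0) g i j =
  \sum_(i in U) \sum_(j in U) g i j +
  2 * (\sum_(i in U) \sum_(j in U0 :\: U) g i j) +
  \sum_(i in U0 :\: U) \sum_(j in U0 :\: U) g i j.
Proof.
move=> UU0 gC; have split1 (f : T -> R) :
    \sum_(i in U0) f i = \sum_(i in U) f i + \sum_(i in U0 :\: U) f i.
  by rewrite (big_setID U) /= (finset.setIidPr UU0).
rewrite split1; under eq_bigr => i _ do rewrite split1.
under [X in _ + X = _]eq_bigr => i _ do rewrite split1.
rewrite !big_split /= [X in _ + (X + _) = _]exchange_big /=.
have -> : \sum_(j in U) \sum_(i in U0 :\: U) g i j =
    \sum_(i in U) \sum_(j in U0 :\: U) g i j.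
  by apply: eq_bigr => i _; apply: eq_bigr => j _.
ring.
Qed.

Section Assembly.
Variables (R : realType) (q n : nat) (w pp : 'I_n -> 'I_n -> R).
Variables (Pi : 'I_n -> 'I_n -> rel 'I_q) (S : {set 'S_q}) (c rho : R).
Hypotheses (q0 : (0 < q)%N) (w0 : forall i j, 0 <= w i j).
Hypotheses (wC : forall i j, w i j = w j i) (ppC : forall i j, w i j * pp i j = w j i * pp j i).
Hypothesis PiC : forall i j, w i j != 0 -> forall a b, Pi j i b a = Pi i j a b.
Hypotheses (trS : uniformly_transitive R S)
  (presS : forall i j, w i j != 0 -> preserves S (Pi i j)).
Hypothesis densPi : forall i j, w i j != 0 -> c <= density R (Pi i j).
Hypotheses (rho0 : 0 <= rho) (c_le : c <= 1 - (q%:R ^+ 2)^-1) (pp1 : forall i j, pp i j <= 1).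

Local Notation assignment := {ffun 'I_n -> 'I_q}.

Let val (U : {set 'I_n}) (x : assignment) :=
  \sum_(i in U) \sum_(j in U) w i j * (Pi i j (x i) (x j))%:R.
Let loss (U : {set 'I_n}) := \sum_(i in U) \sum_(j in U) w i j * (1 - pp i j).

Let loss_ge0 U : 0 <= loss U.
Proof. by do 2!(apply: sumr_ge0 => ? _); rewrite mulr_ge0 ?subr_ge0. Qed.

Lemma sum_weighted_permuted (i j : 'I_n) (a b : 'I_q) :
  c * w i j <= \sum_(s in S) \sum_(s' in S)
    (#|S|%:R^-1 * #|S|%:R^-1) * (w i j * (Pi i j (s a) (s' b))%:R).
Proof.
have -> : \sum_(s in S) \sum_(s' in S)
    (#|S|%:R^-1 * #|S|%:R^-1) * (w i j * (Pi i j (s a) (s' b))%:R) =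
    w i j * density R (Pi i j).
  transitivity (w i j * \sum_(s in S) (\sum_(s' in S)
      (Pi i j (s a) (s' b))%:R / #|S|%:R) / #|S|%:R).
    rewrite mulr_sumr; apply: eq_bigr => s _.
    rewrite mulr_suml mulr_sumr; apply: eq_bigr => s' _; ring.
  congr (_ * _); under eq_bigr => s _ do
    rewrite (sum_uniformly_transitive (fun d => (Pi i j (s a) d)%:R) b trS).
  rewrite (sum_uniformly_transitive (fun d => (\sum_e (Pi i j d e)%:R) / q%:R) a trS).
  by rewrite /density -mulr_suml expr2 invfM mulrA.
have [->|wij] := eqVneq (w i j) 0; first by rewrite mulr0 mul0r.
by rewrite mulrC ler_wpM2l ?densPi.
Qed.

Hypothesis cluster : forall U0 : {set 'I_n}, 0 < inner_weight w U0 ->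
  exists U : {set 'I_n}, [/\ U \subset U0, 0 < inner_weight w U,
    rho * (\sum_(i in U) \sum_(j in U0) w i j) <= inner_weight w U &
    exists x : assignment,
      \sum_(i in U) \sum_(j in U) w i j * pp i j - inner_weight w U / (2 * q%:R ^+ 2)
      <= val U x].

(* Independent random permutations from [S] on the two sides preserve the
   values inside and make every crossing pair uniform. *)
Lemma assemble_clusters (U0 : {set 'I_n}) : exists x : assignment,
  (c + rho / (4 * q%:R ^+ 2)) * inner_weight w U0 -
    \sum_(i in U0) \sum_(j in U0) w i j * (1 - pp i j) <=
  \sum_(i in U0) \sum_(j in U0) w i j * (Pi i j (x i) (x j))%:R.
Proof.
have [k] := ubnP #|U0|; elim: k U0 => // k IH U0; rewrite ltnS => U0k.
rewrite -/(loss U0).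
have [e0|e0] := leP (inner_weight w U0) 0.
  have {}e0 : inner_weight w U0 = 0 by apply/le_anti; rewrite e0 inner_weight_ge0.
  exists [ffun=> Ordinal q0]; apply: (@le_trans _ _ 0).
    by rewrite e0 mulr0 sub0r oppr_le0.
  by do 2!(apply: sumr_ge0 => ? _); rewrite mulr_ge0.
have [U [UU0 eU vol [xU hU]]] := cluster e0.
set W := U0 :\: U.
have Un : U != finset.set0.
  by apply: contraTneq eU => ->; rewrite /inner_weight big_set0 ltxx.
have [|xW hW] := IH W.
  apply: leq_trans U0k; rewrite /W cardsD (finset.setIidPr UU0) ltn_subrL.
  by rewrite !card_gt0 Un; apply: contraNneq Un => U00; rewrite -finset.subset0 -U00.
have splitU0 (x : assignment) : val U0 x = val U x +
    2 * (\sum_(i in U) \sum_(j in W) w i j * (Pi i j (x i) (x j))%:R) + val W x.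
  apply: sum_setID2 => // i j; rewrite (wC j i).
  by have [->|wij] := eqVneq (w i j) 0; [rewrite !mul0r | rewrite (PiC wij)].
pose xs (ss : 'S_q * 'S_q) : assignment :=
  [ffun i => if i \in U then ss.1 (xU i) else ss.2 (xW i)].
pose wt (ss : 'S_q * 'S_q) : R :=
  if (ss.1 \in S) && (ss.2 \in S) then #|S|%:R^-1 * #|S|%:R^-1 else 0.
have wt0 ss : 0 <= wt ss by rewrite /wt; case: ifP => // _; rewrite mulr_ge0 ?invr_ge0.
have sum_wt (F : 'S_q -> 'S_q -> R) : \sum_ss wt ss * F ss.1 ss.2 =
    \sum_(s in S) \sum_(s' in S) #|S|%:R^-1 * #|S|%:R^-1 * F s s'.
  rewrite pair_big /= [RHS]big_mkcond; apply: eq_bigr => ss _.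
  by rewrite /wt; case: ifP => // _; rewrite mul0r.
have Sn : #|S|%:R != 0 :> R by rewrite pnatr_eq0 cards_eq0; case: trS.
have wt1 : \sum_ss wt ss = 1.
  have cst (x : R) : \sum_(s in S) x = #|S|%:R * x by rewrite sumr_const mulr_natl.
  transitivity (\sum_ss wt ss * 1); first by apply: eq_bigr => ss _; rewrite mulr1.
  by have /= -> := sum_wt (fun _ _ => 1); rewrite !cst; field.
have [ss hss] := exists_ge_average (fun ss => val U0 (xs ss)) wt0 wt1.
exists (xs ss); rewrite -/(val U0 (xs ss)); apply: le_trans hss.
pose X := \sum_(i in U) \sum_(j in W) w i j.
pose cross s s' := \sum_(i in U) \sum_(j in W) w i j * (Pi i j (s (xU i)) (s' (xW j)))%:R.
have avg_cross : c * X <= \sum_ss wt ss * cross ss.1 ss.2.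
  rewrite (sum_wt cross) /X /cross mulr_sumr.
  under [leRHS]eq_bigr => s _ do under eq_bigr => s' _ do rewrite mulr_sumr.
  under [leRHS]eq_bigr => s _ do rewrite exchange_big /=.
  rewrite [leRHS]exchange_big /=; apply: ler_sum => i _; rewrite mulr_sumr.
  under [leRHS]eq_bigr => s _ do under eq_bigr => s' _ do rewrite mulr_sumr.
  under [leRHS]eq_bigr => s _ do rewrite exchange_big /=.
  rewrite [leRHS]exchange_big /=; apply: ler_sum => j _.
  exact: sum_weighted_permuted.
have avg : val U xU + 2 * (\sum_ss wt ss * cross ss.1 ss.2) + val W xW <=
    \sum_ss wt ss * val U0 (xs ss).
  have lin (y z : R) : y + 2 * (\sum_ss wt ss * cross ss.1 ss.2) + z =
      \sum_ss wt ss * (y + 2 * cross ss.1 ss.2 + z).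
    rewrite -[in LHS](mulr1 y) -[in LHS](mulr1 z) -wt1 !mulr_sumr -!big_split /=.
    by apply: eq_bigr => r _; ring.
  rewrite lin.
  apply: ler_sum => r _; rewrite /wt; case: ifP => [/andP[rS r'S]|_]; last by rewrite !mul0r.
  apply: ler_wpM2l; first by rewrite mulr_ge0 ?invr_ge0.
  rewrite splitU0; apply: lerD; first apply: lerD.
  - apply: ler_sum => i iU; apply: ler_sum => j jU; rewrite !ffunE iU jU.
    have [->|wij] := eqVneq (w i j) 0; first by rewrite !mul0r.
    rewrite ler_wpM2l // ler_nat; case: (boolP (Pi i j _ _)) => // Pij.
    by rewrite (presS wij rS Pij).
  - rewrite ler_wpM2l // ler_sum // => i iU; rewrite ler_sum // => j.
    by rewrite !ffunE iU finset.inE => /andP[/negbTE -> _].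
  - apply: ler_sum => i iW; apply: ler_sum => j jW; rewrite !ffunE.
    move: iW jW; rewrite !finset.inE => /andP[/negbTE -> _] /andP[/negbTE -> _].
    have [->|wij] := eqVneq (w i j) 0; first by rewrite !mul0r.
    rewrite ler_wpM2l // ler_nat; case: (boolP (Pi i j _ _)) => // Pij.
    by rewrite (presS wij r'S Pij).
apply: le_trans avg.
have eU0 : inner_weight w U0 = inner_weight w U + 2 * X + inner_weight w W.
  exact: sum_setID2.
(* The loss of the crossing edges is dropped; they are credited with [c] only. *)
have lossU0 : loss U + loss W <= loss U0.
  rewrite {3}/loss (sum_setID2 UU0) => [|i j]; last by rewrite !mulrBr ppC (wC i).
  rewrite -/(loss U) -/(loss W) -/W; set L := \sum_(i in U) _.
  suff : 0 <= L by lra.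
  by do 2!(apply: sumr_ge0 => ? _); rewrite mulr_ge0 ?subr_ge0.
have lossU : loss U = inner_weight w U - \sum_(i in U) \sum_(j in U) w i j * pp i j.
  rewrite /loss /inner_weight -sumrB; apply: eq_bigr => i _; rewrite -sumrB.
  by apply: eq_bigr => j _; rewrite mulrBr mulr1.
have volE : \sum_(i in U) \sum_(j in U0) w i j = inner_weight w U + X.
  rewrite -big_split /=; apply: eq_bigr => i _.
  by rewrite (big_setID U) /= (finset.setIidPr UU0).
have qR : 0 < q%:R :> R by rewrite ltr0n.
rewrite -/(loss W) -/(val W xW) in hW; rewrite volE in vol.
have X0 : 0 <= X by do 2!apply: sumr_ge0 => ? _.
pose Q : R := (q%:R ^+ 2)^-1; have cQ : c <= 1 - Q by exact: c_le.
have Q0 : 0 < Q by rewrite invr_gt0 exprn_gt0.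
have rhoE : rho / (4 * q%:R ^+ 2) = rho * Q / 4 by rewrite /Q; field; rewrite gt_eqF.
have eUE : inner_weight w U / (2 * q%:R ^+ 2) = inner_weight w U * Q / 2.
  by rewrite /Q; field; rewrite gt_eqF.
rewrite rhoE in hW *; rewrite eUE in hU; rewrite eU0.
(* As [c <= 1 - Q] and rounding loses [Q / 2], the inside of [U] gains [Q / 2] over [c] per unit of
   weight. By [vol] this covers the gain [rho * Q / 4] claimed on the whole removed weight
   [inner_weight w U + 2 * X]. *)
have : Q * (rho * (inner_weight w U + X)) <= Q * inner_weight w U by rewrite ler_pM2l.
have : c * inner_weight w U <= (1 - Q) * inner_weight w U by rewrite ler_wpM2r // ltW.
have : 0 <= rho * Q * inner_weight w U by rewrite !mulr_ge0 // ltW.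
lra.
Qed.
End Assembly.

(** * Instances *)

Section Density.
Variables (R : realType) (q : nat).
Implicit Types A B : rel 'I_q.

(** Densities lie on a grid of step [1 / q ^ 2]. The resulting gaps at 0 and at 1 let [eps] depend
    on [alpha] and [q] but not on the predicates. *)
Lemma density_nat A : exists2 N, (N <= q ^ 2)%N & density R A = N%:R / q%:R ^+ 2.
Proof.
exists (\sum_(a < q) \sum_(b < q) A a b)%N.
  apply: (@leq_trans (\sum_(a < q) \sum_(b < q) 1)%N).
    by apply: leq_sum => a _; apply: leq_sum => b _; exact: leq_b1.
  by rewrite !sum_nat_const !card_ord muln1.
by rewrite /density natr_sum; congr (_ / _); apply: eq_bigr => a _; rewrite natr_sum.
Qed.

Lemma density_ge0 A : 0 <= density R A.
Proof. by have [N _ ->] := density_nat A; rewrite divr_ge0. Qed.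

Lemma density_le1 A : (0 < q)%N -> density R A <= 1.
Proof.
move=> q0; have [N Nq ->] := density_nat A.
by rewrite ler_pdivrMr ?exprn_gt0 ?ltr0n // mul1r -natrX ler_nat.
Qed.

Lemma density_lt1 A : (0 < q)%N -> density R A < 1 ->
  density R A <= 1 - (q%:R ^+ 2)^-1.
Proof.
move=> q0; have Q0 : 0 < q%:R ^+ 2 :> R by rewrite exprn_gt0 ?ltr0n.
have [N _ ->] := density_nat A; rewrite ltr_pdivrMr // mul1r -natrX ltr_nat => Nq.
rewrite ler_pdivrMr ?natrX // mulrBl mul1r mulVf ?gt_eqF //.
by rewrite lerBrDr -natrX natr1 ler_nat.
Qed.

Lemma density_gt0 A : (0 < q)%N -> 0 < density R A -> (q%:R ^+ 2)^-1 <= density R A.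
Proof.
move=> q0; have Q0 : 0 < q%:R ^+ 2 :> R by rewrite exprn_gt0 ?ltr0n.
have [N _ ->] := density_nat A; rewrite pmulr_lgt0 ?invr_gt0 // ltr0n => N0.
by rewrite ler_peMl ?invr_ge0 ?ler1n ?(ltW Q0).
Qed.

Lemma density_gt0_ex A : 0 < density R A -> exists a b, A a b.
Proof.
have [[a [b ab]]|none] := pselect (exists a b, A a b); first by exists a, b.
rewrite /density big1 ?mul0r ?ltxx // => a _; rewrite big1 // => b _.
by case: (boolP (A a b)) => // ab; case: none; exists a, b.
Qed.

Lemma density_ex_gt0 A a b : A a b -> 0 < density R A.
Proof.
move=> ab; have qR : 0 < q%:R :> R by rewrite ltr0n; case: (a) => ? /(leq_ltn_trans (leq0n _)).
rewrite divr_gt0 ?exprn_gt0 // (bigD1 a) //= ltr_pwDl ?sumr_ge0 // => [|c _].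
  by rewrite (bigD1 b) //= ab ltr_pwDl ?sumr_ge0.
exact: sumr_ge0.
Qed.

Lemma eq_density A B : A =2 B -> density R A = density R B.
Proof. by move=> AB; congr (_ / _); do 2!(apply: eq_bigr => ? _); rewrite AB. Qed.

Lemma density_transpose A : density R (fun a b => A b a) = density R A.
Proof. by rewrite /density exchange_big. Qed.

End Density.

Lemma min_densityP (R : realType) (q k : nat) (P : 'I_k -> rel 'I_q) : (0 < q)%N ->
  (0 < k)%N -> exists l, min_density R P = density R (P l).
Proof.
move=> q0 k0; have le1 l : predT l -> (density R (P l) <= 1)%O by rewrite density_le1.
by have [l _ lE] := eq_bigmin (x := 1) (Ordinal k0) predT _ isT le1; exists l.
Qed.

Section Instance.
Variables (R : realType) (q n : nat) (I : csp R q n).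

(** [csp] leaves [weight] arbitrary off the edges, so it is cut to 0 there. Sums over ordered pairs
    then see each edge twice, hence the factors 2 below. *)
Definition edge_weight i j : R := if edge I i j then weight I i j else 0.

Lemma edge_weight_ge0 i j : 0 <= edge_weight i j.
Proof. by rewrite /edge_weight; case: ifP => // /weight_ge0. Qed.

Lemma edge_weightC i j : edge_weight i j = edge_weight j i.
Proof. by rewrite /edge_weight edge_sym; case: ifP => // /weight_sym. Qed.

Lemma edge_weightii i : edge_weight i i = 0.
Proof. by rewrite /edge_weight edge_irr. Qed.

Lemma edge_weight_edge i j : edge_weight i j != 0 -> edge I i j.
Proof. by rewrite /edge_weight; case: ifP => //; rewrite eqxx. Qed.

Lemma sum_over_edges (G : 'I_n -> 'I_n -> R) :
  (forall i j, edge I i j -> G j i = G i j) ->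
  \sum_i \sum_j edge_weight i j * G i j =
  2 * \sum_(i < n) \sum_(j < n | (i < j)%N && edge I i j) weight I i j * G i j.
Proof.
move=> GC; pose g (i j : 'I_n) := if (i < j)%N then edge_weight i j * G i j else 0.
have gE : \sum_(i < n) \sum_(j < n | (i < j)%N && edge I i j) weight I i j * G i j =
    \sum_i \sum_j g i j.
  apply: eq_bigr => i _; rewrite big_mkcond; apply: eq_bigr => j _.
  by rewrite /g /edge_weight; case: (i < j)%N => //=; case: ifP => //; rewrite mul0r.
rewrite gE -[2]/(1 + 1) mulrDl mul1r [X in _ = _ + X]exchange_big -big_split /=.
apply: eq_bigr => i _; rewrite -big_split /=; apply: eq_bigr => j _.
rewrite /g; case: (ltngtP i j) => [ij|ji|/val_inj <-]; rewrite ?addr0 ?add0r.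
- by [].
- rewrite (edge_weightC j i); have [->|wij] := eqVneq (edge_weight i j) 0.
    by rewrite !mul0r.
  by rewrite (GC i j) // edge_weight_edge.
- by rewrite edge_weightii mul0r.
Qed.

Lemma valueE (x : {ffun 'I_n -> 'I_q}) :
  \sum_i \sum_j edge_weight i j * (constr I i j (x i) (x j))%:R = 2 * value I x.
Proof. by rewrite sum_over_edges // => i j /constr_sym ->. Qed.

Lemma sum_edge_weight : \sum_i \sum_j edge_weight i j = 2.
Proof.
transitivity (\sum_i \sum_j edge_weight i j * 1).
  by do 2!(apply: eq_bigr => ? _); rewrite mulr1.
rewrite (sum_over_edges (G := fun _ _ => 1)) // -[RHS]mulr1 -[X in _ = _ * X](weight_sum1 I).
by congr (_ * _); do 2!(apply: eq_bigr => ? _); rewrite mulr1.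
Qed.

Lemma csp_gt1 : (1 < n)%N.
Proof.
rewrite ltnNge; apply/negP => n1; have := sum_edge_weight.
rewrite big1 => [/eqP|i _]; first by rewrite eq_sym pnatr_eq0.
rewrite big1 // => j _; suff -> : i = j by rewrite edge_weightii.
by apply/val_inj => /=; have := ltn_ord i; have := ltn_ord j; lia.
Qed.

Lemma value_le_opt x : value I x <= opt I.
Proof. exact: le_bigmax. Qed.

Lemma opt_ge0 : 0 <= opt I.
Proof. exact: bigmax_ge_id. Qed.

(** A uniformly random assignment satisfies each constraint with probability its density. *)
Lemma opt_ge_density : (0 < q)%N ->
  \sum_i \sum_j edge_weight i j * density R (constr I i j) <= 2 * opt I.
Proof.
move=> q0; have qR : q%:R != 0 :> R by rewrite pnatr_eq0 -lt0n.
pose p (_ : 'I_n) (_ : 'I_q) : R := q%:R^-1.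
have p1 i : \sum_a p i a = 1 by rewrite sumr_const card_ord -[_^-1 *+ _]mulr_natl divff.
have wt0 (x : {ffun 'I_n -> 'I_q}) : 0 <= \prod_i p i (x i).
  by apply: prodr_ge0 => i _; rewrite invr_ge0.
have [x hx] := exists_ge_average (fun x => 2 * value I x) wt0 (sum_prod_weight p1).
apply: le_trans (_ : 2 * value I x <= _); last by rewrite ler_pM2l // value_le_opt.
apply: le_trans hx; rewrite le_eqVlt; apply/orP; left; apply/eqP.
under [RHS]eq_bigr => y _ do rewrite -valueE mulr_sumr.
rewrite [RHS]exchange_big; apply: eq_bigr => i _.
under [RHS]eq_bigr => y _ do rewrite mulr_sumr.
rewrite [RHS]exchange_big; apply: eq_bigr => j _ /=.
have [<-|ij] := eqVneq i j.
  by rewrite edge_weightii mul0r big1 // => y _; rewrite mul0r mulr0.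
under [RHS]eq_bigr => y _ do rewrite mulrCA.
rewrite -mulr_sumr (sum_prod_weight2 p1 (fun a b => (constr I i j a b)%:R) ij).
congr (_ * _); rewrite /density mulr_suml; apply: eq_bigr => a _.
by rewrite mulr_suml; apply: eq_bigr => b _; rewrite /p -invfM -expr2 mulrC.
Qed.

End Instance.

Section PairProb.
Variables (R : realType) (q n t : nat) (mu : local_family R q n).
Hypotheses (q0 : (0 < q)%N) (pd : pseudodistribution t mu) (t2 : (2 <= t)%N) (tn : (t <= n)%N).

Let a0 : 'I_q := Ordinal q0.

Let hull_pair (i j : 'I_n) :
  exists S : {set 'I_n}, [/\ #|S| = t, [set i; j]%SET \subset S &
    forall B, pair_prob t mu i j B = local_E mu a0 S (fun x => (B (x i) (x j))%:R)].
Proof.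
have [|hc hs] := @hullP n t tn [set i; j]%SET.
  by apply: leq_trans t2; rewrite cards2; case: (_ != _).
exists (hull t [set i; j]%SET); split=> // B; exact: pair_probE.
Qed.

Lemma pair_prob_le1 i j B : pair_prob t mu i j B <= 1.
Proof.
have [S [hc _ ->]] := hull_pair i j; have [mu0 mu1] := proj1 pd S hc.
rewrite -[leRHS]mu1; apply: ler_sum => g _; apply: ler_piMr; first exact: mu0. 
by case: (B _ _).
Qed.

Lemma pair_probC i j B : pair_prob t mu j i (fun a b => B b a) = pair_prob t mu i j B.
Proof.
have [S [hc hs ->]] := hull_pair i j.
by rewrite (@pair_probE _ _ _ _ _ a0 pd j i S) // finset.setUC.
Qed.

Lemma eq_pair_prob i j B B' : B =2 B' -> pair_prob t mu i j B = pair_prob t mu i j B'.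
Proof.
by move=> BB'; rewrite /pair_prob; apply: eq_bigl => f; rewrite BB'.
Qed.

(** Either [B] is empty and both sides are 0, or its density is at least [1 / q ^ 2]. This serves
    the case where some predicate is empty. *)
Lemma pair_prob_le_density i j B : pair_prob t mu i j B <= q%:R ^+ 2 * density R B.
Proof.
have qR : 0 < q%:R :> R by rewrite ltr0n.
have [d0|d0] := ltP 0 (density R B).
  apply: le_trans (pair_prob_le1 i j B) _.
  by rewrite -ler_pdivrMl ?exprn_gt0 // mulr1 density_gt0.
apply: (@le_trans _ _ 0); last by rewrite mulr_ge0 ?density_ge0 ?exprn_ge0 // ltW.
have [S [hc _ ->]] := hull_pair i j; apply: sumr_le0 => g _.
case: (boolP (B _ _)) => [Bab|_]; last by rewrite mulr0.
by have := density_ex_gt0 R Bab; rewrite ltNge d0.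
Qed.
End PairProb.

Lemma sa_degree_ge2 (R : realType) (alpha : R) n : (1 < n)%N -> (2 <= sa_degree n alpha)%N.
Proof. by move=> n1; rewrite leq_min n1 leq_max. Qed.

(** The 8 is the exponent 4 from the room needed for conditioning times 2 for rounding the walk
    length up to a power of two. [8 <= N] takes care of the clamp at [n], and [8 <= N * alpha] of
    [n ^ alpha]. *)
Lemma leq_sa_degree (R : realType) (alpha : R) (H N m n : nat) :
  (0 < H)%N -> (8 <= N)%N -> 8 <= N%:R * alpha ->
  ((H ^ N) ^ (2 ^ m) < n)%N -> ((H ^ (2 ^ m.+1)) ^ 4 <= sa_degree n alpha)%N.
Proof.
move=> H0 N8 Na; set l := (2 ^ m)%N => nl.
have -> : ((H ^ (2 ^ m.+1)) ^ 4 = H ^ (8 * l))%N by rewrite -expnM expnS; congr (_ ^ _)%N; lia.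
rewrite leq_min leq_max; apply/andP; split.
  by rewrite (leq_trans _ (ltnW nl)) // -expnM leq_pexp2l // leq_mul2r N8 orbT.
apply/orP; right; rewrite truncn_ge_nat ?powR_ge0 // natrX -powR_mulrn //.
have H1 : 1 <= H%:R :> R by rewrite ler1n.
apply: (@le_trans _ _ ((H%:R `^ (N * l)%:R) `^ alpha)).
  rewrite -powRrM ler_powR // !natrM.
  have : 8 * l%:R <= N%:R * alpha * l%:R by rewrite ler_wpM2r.
  by rewrite mulrAC.
have alpha0 : 0 <= alpha.
  rewrite leNgt; apply/negP => a0; have : N%:R * alpha <= 0 by rewrite mulr_ge0_le0 // ltW.
  by lra.
rewrite ge0_ler_powR ?nnegrE ?powR_ge0 // powR_mulrn // -natrX ler_nat.
by rewrite expnM ltnW.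
Qed.

(** * Gain over the minimal density from one pseudodistribution *)

Section MaxCsp.
Variables (R : realType) (q k n : nat) (P : 'I_k -> rel 'I_q) (I : csp R q n).
Hypotheses (q0 : (0 < q)%N) (maxI : max_csp P I).

Lemma min_density_le_constr i j : edge I i j -> min_density R P <= density R (constr I i j).
Proof.
move=> ij; have [l cP] := maxI ij; apply: le_trans (bigmin_le 1 l _) _.
case: cP => cP; first by rewrite (eq_density _ cP).
rewrite -(density_transpose _ (constr I i j)) le_eqVlt; apply/orP; left; apply/eqP.
by apply: eq_density => a b; rewrite -cP; exact: constr_sym.
Qed.

Lemma preserves_constr (S : {set 'S_q}) : (forall l, preserves S (P l)) ->
  forall i j, edge I i j -> preserves S (constr I i j).
Proof.
move=> presS i j ij s sS a b; have [l [cP|cP]] := maxI ij.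
  by rewrite !cP; exact: presS.
by rewrite -!(constr_sym ij) !cP; exact: presS.
Qed.

Section PseudoValue.
Variables (t : nat) (mu : local_family R q n).
Hypotheses (pd : pseudodistribution t mu) (t2 : (2 <= t)%N) (tn : (t <= n)%N).

Let pp i j := pair_prob t mu i j (constr I i j).

Lemma pair_prob_constrC i j : edge I i j -> pp j i = pp i j.
Proof.
move=> ij; rewrite -[RHS](pair_probC q0 pd t2 tn); apply: eq_pair_prob => a b.
exact: constr_sym.
Qed.

Lemma pseudo_valueE :
  \sum_i \sum_j edge_weight I i j * pp i j = 2 * pseudo_value t I mu.
Proof. by rewrite sum_over_edges // => i j; exact: pair_prob_constrC. Qed.

Lemma pseudo_value_le1 : pseudo_value t I mu <= 1.
Proof.
rewrite -(ler_pM2l (ltr0Sn R 1)) mulr1 -pseudo_valueE -(sum_edge_weight I).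
do 2!(apply: ler_sum => ? _); rewrite ler_piMr ?edge_weight_ge0 //.
exact: (pair_prob_le1 q0 pd).
Qed.

Lemma pseudo_value_le_opt : pseudo_value t I mu <= q%:R ^+ 2 * opt I.
Proof.
rewrite -(ler_pM2l (ltr0Sn R 1)) -pseudo_valueE mulrCA.
apply: le_trans (_ : q%:R ^+ 2 * \sum_i \sum_j edge_weight I i j *
    density R (constr I i j) <= _); last by rewrite ler_wpM2l ?opt_ge_density ?exprn_ge0.
rewrite mulr_sumr; apply: ler_sum => i _; rewrite mulr_sumr; apply: ler_sum => j _.
by rewrite mulrCA ler_wpM2l ?edge_weight_ge0 // (pair_prob_le_density q0 pd).
Qed.

Lemma opt_ge_pseudo_value (S : {set 'S_q}) (N : nat) :
  let H := (16 * q ^ 6)%N in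
  let rho : R := (18 * (H ^ N) ^ 2)%:R^-1 ^+ N.+1 / 2 in
  uniformly_transitive R S -> (forall l, preserves S (P l)) ->
  0 < min_density R P <= 1 - (q%:R ^+ 2)^-1 -> (0 < N)%N ->
  (forall m, ((H ^ N) ^ (2 ^ m) < n)%N -> ((H ^ (2 ^ m.+1)) ^ 4 <= t)%N) ->
  min_density R P + rho / (4 * q%:R ^+ 2) - (1 - pseudo_value t I mu) <= opt I.
Proof.
move=> H rho trS presS /andP[c0 c1] N0 Ht.
pose w := edge_weight I.
have w0 i j : 0 <= w i j by exact: edge_weight_ge0.
have wC i j : w i j = w j i by exact: edge_weightC.
have wii i : w i i = 0 by exact: edge_weightii.
have wE i j : w i j != 0 -> edge I i j by exact: edge_weight_edge.
have qq : (0 < q ^ 6)%N by rewrite expn_gt0 q0.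
have H16 : (16 <= H)%N by rewrite /H; lia.
have A16 : (16 <= H ^ N)%N.
  by rewrite (leq_trans H16) // -{1}[H]expn1 leq_pexp2l // (leq_trans _ H16).
have rho0 : 0 <= rho by rewrite divr_ge0 // exprn_ge0 // invr_ge0.
have ppC i j : w i j * pp i j = w j i * pp j i.
  rewrite wC; have [->|wij] := eqVneq (w j i) 0; first by rewrite !mul0r.
  by rewrite (pair_prob_constrC (wE _ _ wij)).
have pp1 i j : pp i j <= 1 by exact: (pair_prob_le1 q0 pd).
have PiC i j : w i j != 0 -> forall a b, constr I j i b a = constr I i j a b.
  by move/wE; exact: constr_sym.
have sat i j : w i j != 0 -> exists a b, constr I i j a b.
  by move/wE/min_density_le_constr/(lt_le_trans c0)/density_gt0_ex.
have cluster (U0 : {set 'I_n}) : 0 < inner_weight w U0 ->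
    exists U : {set 'I_n}, [/\ U \subset U0, 0 < inner_weight w U,
    rho * (\sum_(i in U) \sum_(j in U0) w i j) <= inner_weight w U &
    exists x : {ffun 'I_n -> 'I_q},
      \sum_(i in U) \sum_(j in U) w i j * pp i j - inner_weight w U / (2 * q%:R ^+ 2)
      <= \sum_(i in U) \sum_(j in U) w i j * (constr I i j (x i) (x j))%:R].
  move=> e0; have [small|large] := leqP n (H ^ N).
    have [U [UU0 eU vol [x hx]]] := heaviest_edge_rounding w0 wC wii PiC sat e0.
    exists U; split=> //.
      apply: le_trans vol; apply: ler_wpM2r.
        by apply: sumr_ge0 => i _; apply: sumr_ge0.
      set B : R := (18 * (H ^ N) ^ 2)%:R^-1.
      have B0 : 0 <= B by rewrite invr_ge0.
      have AR : 1 <= (H ^ N)%:R :> R by rewrite ler1n (leq_trans _ A16).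
      have A0 : (0 < H ^ N)%N by rewrite (leq_trans _ A16).
      have B_le : B <= (H ^ N)%:R^-1.
        have A2 : (0 < 18 * (H ^ N) ^ 2)%N by rewrite muln_gt0 expn_gt0 A0.
        rewrite lef_pV2 ?posrE ?ltr0n // ler_nat.
        by rewrite -{1}[(H ^ N)%N]mul1n leq_mul // expnS expn1 leq_pmulr.
      have B1 : B <= 1 by apply: le_trans B_le _; rewrite invf_le1 // (lt_le_trans ltr01).
      apply: (@le_trans _ _ B).
        rewrite /rho -/B exprS ler_pdivrMr // ler_wpM2l //.
        by have := exprn_ile1 N B0 B1; lra.
      apply: le_trans B_le _; rewrite lef_pV2 ?posrE ?ltr0n ?ler_nat //.
      exact: ltnW (csp_gt1 I).
    exists x; apply: le_trans hx; rewrite lerBlDr.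
    apply: (@le_trans _ _ (inner_weight w U)).
      by do 2!(apply: ler_sum => ? _); rewrite ler_piMr.
    by rewrite lerDl divr_ge0 ?(ltW eU) // mulr_ge0 ?exprn_ge0.
  (* The least such [m] is positive here, and [n] exceeds the bound for its predecessor; the
     hypothesis [Ht] on [t] needs this lower bound on [n]. *)
  have [m mE mmin] : {m | (n <= (H ^ N) ^ (2 ^ m))%N &
      forall m', (n <= (H ^ N) ^ (2 ^ m'))%N -> (m <= m')%N}.
    have ex : exists m, (n <= (H ^ N) ^ (2 ^ m))%N.
      have A1 : (1 < H ^ N)%N by rewrite (leq_trans _ A16).
      by exists n; rewrite ltnW // (leq_trans (ltn_expl n (ltnSn 1))) // ltnW // ltn_expl.
    by case: (ex_minnP ex) => m ? ?; exists m.
  case: m mE mmin => [|m] mE mmin; first by rewrite expn0 expn1 leqNgt large in mE.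
  apply: (cluster_rounding (m := m.+1) _ pd tn q0 N0 mE (Ht m _)) => //.
  by rewrite ltnNge; apply/negP => /mmin; rewrite ltnn.
have [x hx] := assemble_clusters q0 w0 wC ppC PiC trS
  (fun i j wij => preserves_constr presS (wE i j wij))
  (fun i j wij => min_density_le_constr (wE i j wij)) rho0 c1 pp1 cluster [set: 'I_n]%SET.
have sumT (g : 'I_n -> 'I_n -> R) :
    \sum_(i in [set: 'I_n]%SET) \sum_(j in [set: 'I_n]%SET) g i j = \sum_i \sum_j g i j.
  rewrite (eq_bigl predT) => [|i]; last by rewrite finset.in_setT.
  by apply: eq_bigr => i _; apply: eq_bigl => j; rewrite finset.in_setT.
move: hx; rewrite /inner_weight !sumT sum_edge_weight valueE.
have -> : \sum_i \sum_j w i j * (1 - pp i j) = 2 - 2 * pseudo_value t I mu.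
  rewrite -pseudo_valueE -(sum_edge_weight I) -sumrB; apply: eq_bigr => i _.
  by rewrite -sumrB; apply: eq_bigr => j _; rewrite mulrBr mulr1.
by have := value_le_opt I x; lra.
Qed.

End PseudoValue.
End MaxCsp.

(** * Choice of the constants and the approximation ratio *)

Theorem theorem4p6 (R : realType) (q : nat) (hq : (0 < q)%N)
    (alpha : R) (halpha : 0 < alpha) :
  exists2 eps : R, 0 < eps &
    forall (k : nat) (P : 'I_k -> rel 'I_q) (S : {set 'S_q}),
      (0 < k)%N ->
      uniformly_transitive R S ->
      (forall l, preserves S (P l)) ->
      min_density R P < 1 ->
      SA_approximates alpha (min_density R P + eps) (@max_csp R q k P).
Proof.
pose H := (16 * q ^ 6)%N; pose N := maxn 8 (Num.bound (8 / alpha)).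
have N8 : (8 <= N)%N by rewrite leq_maxl.
have N0 : (0 < N)%N by apply: leq_trans N8.
have Na : 8 <= N%:R * alpha.
  have b8 : 0 <= 8 / alpha by rewrite divr_ge0 // ltW.
  rewrite -ler_pdivrMr // (le_trans (ltW (archi_boundP b8))) //.
  by rewrite ler_nat leq_maxr.
have H0 : (0 < H)%N by rewrite muln_gt0 expn_gt0 hq.
set Q : R := (q%:R ^+ 2)^-1.
have Q0 : 0 < Q by rewrite invr_gt0 exprn_gt0 // ltr0n.
have Q1 : Q <= 1 by rewrite invf_le1 ?exprn_gt0 ?ltr0n // exprn_ege1 // ler1n.
pose rho : R := (18 * (H ^ N) ^ 2)%:R^-1 ^+ N.+1 / 2.
have rho0 : 0 < rho.
  by rewrite divr_gt0 // exprn_gt0 // invr_gt0 ltr0n muln_gt0 !expn_gt0 H0.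
have rho1 : rho <= 1.
  rewrite ler_pdivrMr // mul1r (@le_trans _ _ 1) ?ler1n // exprn_ile1 ?invr_ge0 //.
  by rewrite invf_le1 ?ltr0n ?ler1n muln_gt0 !expn_gt0 H0.
(* [eps1] is the additive gain over [c] at [v = 1], and half of it survives while
   [1 - v <= eps1 / 2]. For smaller [v] the factor [v] saves at least [c * eps1 / 2] on the term
   [c], and [Q <= c] if [c] is positive; [eps] suits both cases. *)
pose eps1 := rho * Q / 4; pose eps := eps1 * Q / 2.
have eps1_0 : 0 < eps1 by rewrite divr_gt0 // mulr_gt0.
have eps1Q : eps1 <= Q / 4 by rewrite /eps1 ler_pM2r ?invr_gt0 // ler_piMl // ltW.
exists eps; first by rewrite divr_gt0 // mulr_gt0.
move=> k P S k0 trS presS c1 n I maxI.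
set c := min_density R P in c1 *; set t := sa_degree n alpha.
have n2 := csp_gt1 I.
have tn : (t <= n)%N by exact: geq_minl.
have t2 : (2 <= t)%N := sa_degree_ge2 alpha n2.
have [l cE] := min_densityP R P hq k0.
have cQ : c <= 1 - Q by rewrite /c cE density_lt1 // -cE.
have c0 : 0 <= c by rewrite /c cE density_ge0.
have opt0 := opt_ge0 I.
have optc : c <= opt I.
  rewrite -(ler_pM2l (ltr0Sn R 1)); apply: le_trans (opt_ge_density I hq).
  rewrite -(sum_edge_weight I) mulr_suml; apply: ler_sum => i _.
  rewrite mulr_suml; apply: ler_sum => j _.
  have [->|wij] := eqVneq (edge_weight I i j) 0; first by rewrite !mul0r.
  by rewrite ler_wpM2l ?edge_weight_ge0 // (min_density_le_constr maxI) // edge_weight_edge.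
have eps0 : 0 < eps by rewrite divr_gt0 // mulr_gt0.
suff main mu : pseudodistribution t mu -> (c + eps) * pseudo_value t I mu <= opt I.
  have ceps : 0 < c + eps by rewrite ltr_wpDl.
  rewrite -ler_pdivlMl // /SA; set E := (X in sup X).
  (* The supremum of the empty set is 0 by convention, which is at most [opt I]. *)
  have [->|/set0P E0] := eqVneq E set0.
    by rewrite sup0 mulr_ge0 // invr_ge0 ltW.
  apply: ge_sup => //.
  by move=> _ [mu pd ->]; rewrite ler_pdivlMl //; exact: main.
move=> pd; set v := pseudo_value t I mu.
have v1 : v <= 1 := pseudo_value_le1 I hq pd t2 tn.
have [v0|v0] := leP v 0.
  by apply: le_trans opt0; rewrite mulr_ge0_le0 // addr_ge0 // ltW.
(* For [c = 0] the bound [Q <= c] fails, but then the target is only [eps * v], and [Q * v <= opt I]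
   with [eps <= Q]. *)
have [cz|cpos] := leP c 0.
  have {cz} -> : c = 0 by apply/le_anti; rewrite cz c0.
  have : v <= q%:R ^+ 2 * opt I := pseudo_value_le_opt I hq pd t2 tn.
  move/(ler_wpM2l (ltW Q0)); rewrite mulrA mulVf ?mul1r; last first.
    by rewrite expf_neq0 // pnatr_eq0 -lt0n.
  have : eps <= Q by rewrite /eps; have := ler_pM (ltW eps1_0) (ltW Q0) eps1Q Q1; lra.
  by move/(ler_wpM2r (ltW v0)); rewrite add0r; lra.
have cQ' : Q <= c by rewrite /c cE density_gt0 // -cE.
have key : c + eps1 - (1 - v) <= opt I.
  have -> : eps1 = rho / (4 * q%:R ^+ 2).
    by rewrite /eps1 /Q; field; rewrite pnatr_eq0 -lt0n.
  apply: (opt_ge_pseudo_value hq maxI pd t2 tn trS presS _ N0); first by rewrite cpos.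
  by move=> m; apply: leq_sa_degree.
have e1 : eps1 * Q <= eps1 * c by rewrite ler_pM2l.
(* If [v] is not close to 1, the value [c] of a random assignment suffices. *)
have [near1|far] := leP (1 - v) (eps1 / 2).
  have : eps1 * Q <= eps1 by rewrite ler_piMr // ltW.
  have : (c + eps) * v <= c + eps by rewrite ler_piMr // addr_ge0 // ltW.
  by rewrite /eps; lra.
have : (c + eps) * v <= (c + eps) * (1 - eps1 / 2).
  by rewrite ler_wpM2l ?addr_ge0 ?(ltW eps0) //; lra.
have : 0 <= eps * (eps1 / 2) by rewrite mulr_ge0 ?divr_ge0 // ltW.
by rewrite /eps; lra.
Qed.
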